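(* Let $n > m \geq 2$ be integers, let $A \subset \{0,1,\ldots,n-1\}\times\{0,1,\ldots,m-1\}$ be non-empty, and let $$S = S(A) = \left\{ \left( \sum_{i=1}^{\infty} \frac{x_i}{n^i},\ \sum_{i=1}^{\infty} \frac{y_i}{m^i} \right) : (x_i,y_i) \in A \text{ for all } i \geq 1 \right\} \subset \mathbb{R}^2 .$$ For $0 \leq j < m$ let $t_j$ be the number of elements of $A$ of the form $(i,j)$, let $s = |\{j : t_j \neq 0\}|$, and let $t = \max\{t_j : 0 \leq j < m\}$. If both $t<n$ and $s<m$, then the conformal Assouad dimension of $S$ is $\mathcal{C}\mathrm{dim}_A(S)=0$. Otherwise, $S$ is minimal for conformal Assouad dimension, i.e., $\mathcal{C}\mathrm{dim}_A(S)=\dim_A(S)$.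
   Context: The set $S\subset\mathbb{R}^2$ carries the Euclidean metric. The Assouad dimension $\dim_A(X)$ of a metric space $X$ is the infimum of all $\alpha>0$ for which there exists a constant $C>0$ such that for any $r,R$ with $0 < r \leq \frac12 R \leq \operatorname{diam}(X)$, any ball $B(x,R)\subset X$ may be covered by at most $C (R/r)^\alpha$ balls of radius $r$. A homeomorphism $f:X\to Y$ of metric spaces is quasi-symmetric if there is a homeomorphism $\eta:[0,\infty)\to[0,\infty)$ such that for all $x,a,b\in X$ with $x \neq b$, $\frac{d_Y(f(x),f(a))}{d_Y(f(x),f(b))} \leq \eta\left(\frac{d_X(x,a)}{d_X(x,b)}\right)$. The conformal Assouad dimension $\mathcal{C}\mathrm{dim}_A(X)$ is the infimum of $\dim_A(Y)$ over all metric spaces $Y$ for which there is a quasi-symmetric homeomorphism $X\to Y$. *)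

(* Defs.v *)
From HB Require Import structures.
From mathcomp Require Export all_boot all_order all_algebra.
From mathcomp Require Export all_classical all_reals all_analysis.
From mathcomp Require Import ring lra.

Set Implicit Arguments.
Unset Strict Implicit.
Unset Printing Implicit Defensive.

Import Order.TTheory GRing.Theory Num.Theory.
Import numFieldNormedType.Exports.

Local Open Scope classical_set_scope.
Local Open Scope ring_scope.

(* The distance is the one inducing the pseudometric that the library already
   puts on [set_type A]. *)
Section subset_metric.
Context {R : realType} {T : metricType R} (A : set T).
Implicit Types x y : set_type A.

Definition subset_dist x y : R := mdist (set_val x) (set_val y).

Lemma subset_dist_ge0 x y : 0 <= subset_dist x y.
Proof. exact: mdist_ge0. Qed.

Lemma subset_dist_positivity x y : subset_dist x y = 0 -> x = y.
Proof. by move=> /mdist_positivity/val_inj. Qed.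

Lemma ballE_subset_dist x d : ball x d = [set y | subset_dist x y < d].
Proof. by rewrite -initial_ballE ballEmdist. Qed.

HB.instance Definition _ := PseudoMetric_isMetric.Build R (set_type A)
  subset_dist_ge0 subset_dist_positivity ballE_subset_dist.

End subset_metric.

(* A copy of [R * R], whose own metric in the library is the sup metric. *)
Definition plane (R : realType) : Type := (R * R)%type.

HB.instance Definition _ (R : realType) := Choice.copy (plane R) (R * R)%type.

Section euclidean_metric.
Context {R : realType}.
Implicit Types p q : plane R.

Definition euclidean_dist p q : R :=
  Num.sqrt ((p.1 - q.1) ^+ 2 + (p.2 - q.2) ^+ 2).

Lemma euclidean_distxx p : euclidean_dist p p = 0.
Proof. by rewrite /euclidean_dist !subrr expr0n addr0 sqrtr0. Qed.

Lemma euclidean_dist_positivity p q : euclidean_dist p q = 0 -> p = q.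
Proof.
move=> /eqP; rewrite sqrtr_eq0 => h.
have h1 := sqr_ge0 (p.1 - q.1); have h2 := sqr_ge0 (p.2 - q.2).
have /eqP : (p.1 - q.1) ^+ 2 = 0 by lra.
have /eqP : (p.2 - q.2) ^+ 2 = 0 by lra.
rewrite !sqrf_eq0 !subr_eq0.
by case: p q {h h1 h2} => [? ?] [? ?] /= /eqP -> /eqP ->.
Qed.

Lemma euclidean_dist_sym p q : euclidean_dist p q = euclidean_dist q p.
Proof. by congr Num.sqrt; ring. Qed.

Lemma euclidean_dist_triangle q p r :
  euclidean_dist p r <= euclidean_dist p q + euclidean_dist q r.
Proof.
rewrite /euclidean_dist.
set a := p.1 - q.1; set b := p.2 - q.2; set c := q.1 - r.1; set d := q.2 - r.2.
have -> : p.1 - r.1 = a + c by rewrite /a /c; ring.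
have -> : p.2 - r.2 = b + d by rewrite /b /d; ring.
have ab0 : 0 <= a ^+ 2 + b ^+ 2 by rewrite addr_ge0 ?sqr_ge0.
have cd0 : 0 <= c ^+ 2 + d ^+ 2 by rewrite addr_ge0 ?sqr_ge0.
have h : a * c + b * d <=
    Num.sqrt (a ^+ 2 + b ^+ 2) * Num.sqrt (c ^+ 2 + d ^+ 2).
  rewrite -sqrtrM// (le_trans (ler_norm _))// -sqrtr_sqr ler_wsqrtr//.
  have := sqr_ge0 (a * d - b * c); nra.
have su := sqr_sqrtr ab0; have sv := sqr_sqrtr cd0.
rewrite -[leRHS]ger0_norm ?addr_ge0 ?sqrtr_ge0// -sqrtr_sqr ler_wsqrtr//.
move: (Num.sqrt (a ^+ 2 + b ^+ 2)) (Num.sqrt (c ^+ 2 + d ^+ 2)) h su sv => u v.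
nra.
Qed.

HB.instance Definition _ := @isMetric.Build R (plane R) euclidean_dist
  euclidean_distxx euclidean_dist_positivity euclidean_dist_sym
  euclidean_dist_triangle.

End euclidean_metric.

Definition homeomorphism (X Y : topologicalType) (f : X -> Y) :=
  exists g : Y -> X, [/\ cancel f g, cancel g f, continuous f & continuous g].

Section conformal_dimension.
Context {R : realType}.

Definition half_line : set R := `[0, +oo[.

Definition diam (X : metricType R) : \bar R :=
  ereal_sup [set d | exists x y : X, d = (mdist x y)%:E].

(* Balls are open, with centres in [X]. *)
Definition assouad_exponent (X : metricType R) (alpha : R) :=
  exists2 C : R, 0 < C &
    forall r r' : R, 0 < r -> r <= r' / 2 -> ((r' / 2)%:E <= diam X)%E ->
    forall x : X, exists s : seq X,
      (size s)%:R <= C * (r' / r) `^ alpha /\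
      ball x r' `<=` \bigcup_(y in [set` s]) ball y r.

Definition assouad_dim (X : metricType R) : \bar R :=
  ereal_inf [set alpha%:E | alpha in
               [set alpha : R | 0 < alpha /\ assouad_exponent X alpha]].

Section ratio.
Context {X : metricType R} (x a b : X).

Lemma dist_ratio_subproof : mdist x a / mdist x b \in half_line.
Proof. by rewrite inE /half_line/= in_itv/= andbT divr_ge0 ?mdist_ge0. Qed.

Definition dist_ratio : half_line := SigSub dist_ratio_subproof.

End ratio.

Definition quasisymmetric (X Y : metricType R) (f : X -> Y) :=
  homeomorphism f /\
  exists2 eta : half_line -> half_line, homeomorphism eta &
    forall x a b : X, x <> b ->
      mdist (f x) (f a) / mdist (f x) (f b) <= \val (eta (dist_ratio x a b)).

Definition conformal_assouad_dim (X : metricType R) : \bar R :=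
  ereal_inf [set d | exists2 Y : metricType R,
               (exists f : X -> Y, quasisymmetric f) & d = assouad_dim Y].

End conformal_dimension.

Section carpet.
Context (R : realType) (n m : nat) (A : {set 'I_n * 'I_m}).

Definition digit_series (b : nat) (x : nat -> nat) : R :=
  limn (fun N => \sum_(1 <= i < N) ((x i)%:R / b%:R ^+ i : R)).

(* The value of [a] at 0 is not used: digits are numbered from 1. *)
Definition carpet : set (plane R) :=
  [set p | exists2 a : nat -> 'I_n * 'I_m,
     (forall i, (1 <= i)%N -> a i \in A) &
     p = (digit_series n (fun i => (a i).1), digit_series m (fun i => (a i).2))].

Definition row_count (j : 'I_m) : nat := #|[pred a in A | a.2 == j]|.

Definition num_rows : nat := #|[pred j : 'I_m | row_count j != 0%N]|.

Definition max_row_count : nat := (\max_(j < m) row_count j)%N.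

End carpet.

Arguments carpet R {n m} A.

(* Main.v *)
From HB Require Import structures.
Require Import Defs.
From mathcomp Require Import zify ring lra.

(** Put alpha = log_m s + log_n t.  Because m < n, the natural piece of the
carpet at scale r is not a rectangle of the construction but an approximate
square: fix the first a digits of x and the first b digits of y, where n^-a and
m^-b are both about r, so that a <= b.

The Assouad dimension is at most alpha.  To refine an approximate square of
scale R to scale r, choose first the new digits of y, with s possibilities
each; the rows of the new digits of x are then known, since a <= b, and each
of them leaves at most t possibilities.  This gives about (R/r)^alpha pieces
([carpet_covering_exponent]).

If t < n and s < m, the carpet is uniformly disconnected: a chain of points of
the carpet with steps at most e stays in a set of diameter O(e)
([carpet_uniformly_disconnected]).  Reading the first digits of y as an
integer, a chain changes this integer by at most 1 at each step, and it can
never take a value ending in the digit of an empty row, so it is trapped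
between two such values.  Only two words of rows then occur.  Each row misses
a digit of x, so some word of two digits of x is impossible for both words of
rows, and the integer read from x is trapped in the same way.  On a uniformly
disconnected space the largest step needed to join two points by a chain is an
ultrametric comparable with the distance.  All powers of an ultrametric are
metrics; the power p is quasi-symmetric to the original and divides covering
exponents by p, so the conformal dimension is 0
([conformal_assouad_dim_eq0]).

If t = n or s = m, then alpha = 1 + q, where q is the other logarithm, and the
carpet contains, at all resolutions N, grids that look like the product of a
segment cut into N steps with about N^q points of a Cantor set of dimension q
([grids_full_row], [grids_full_column]).  Let f be a quasi-symmetric map to Y
and let d range over the distances of the images of consecutive grid points.
In the image each of the N^q segments has length at least comparable to the
diameter D, so that the sum of the d is at least of the order of N^q D; as
there are about N^(1+q) of them, the sum of the d^(1+q) is at least of the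
order of D^(1+q).  If Y had an Assouad exponent beta < 1 + q, then only
(D/tau)^beta of the d, up to a constant, could exceed tau, because large steps
belong to well separated points; as moreover all d are at most eps D with
eps -> 0, the sum of the d^(1+q) would be at most of the order of
eps^(1+q-beta) D^(1+q), a contradiction ([assouad_exponent_ge_grids]).  Hence
  every quasi-symmetric image
has dimension at least alpha, and the carpet itself has dimension at most
alpha. *)

Set Implicit Arguments.
Unset Strict Implicit.
Unset Printing Implicit Defensive.

Import Order.TTheory GRing.Theory Num.Theory.
Import numFieldNormedType.Exports.

Local Open Scope classical_set_scope.
Local Open Scope ring_scope.

(** * Digits and base expansions *)

(** A word of [k] digits is handled as one integer: closeness of real numbers
becomes closeness of integers, whereas the digits themselves may all differ
on both sides of a carry. *)
Fixpoint prefix_num (b : nat) (x : nat -> nat) (k : nat) : nat :=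
  if k is k'.+1 then (b * prefix_num b x k' + x k'.+1)%N else 0%N.

Lemma prefix_numD b x k j : (forall i, (x i < b)%N) ->
  (prefix_num b x k * b ^ j <= prefix_num b x (k + j) <
   (prefix_num b x k).+1 * b ^ j)%N.
Proof.
move=> xb; elim: j => [|j /andP[IH1 IH2]];
  first by rewrite addn0 expn0 !muln1 leqnn ltnSn.
rewrite addnS /= expnS; have := xb (k + j).+1.
move: (x (k + j).+1) (prefix_num b x (k + j)) (prefix_num b x k) (b ^ j)%N IH1 IH2.
move=> d p q B h1 h2 hd; apply/andP; split; first nia.
have : ((p.+1) * b <= q.+1 * B * b)%N by rewrite leq_mul2r h2 orbT.
nia.
Qed.

Lemma prefix_num_div b x k i : (forall i, (x i < b)%N) -> (i <= k)%N ->
  (prefix_num b x k %/ b ^ (k - i))%N = prefix_num b x i.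
Proof.
move=> xb ik; have := prefix_numD i (k - i) xb; rewrite subnKC// => /andP[h1 h2].
have b0 : (0 < b ^ (k - i))%N by rewrite expn_gt0 (leq_ltn_trans _ (xb 0%N)).
by apply/eqP; rewrite eqn_leq -ltnS ltn_divLR// h2 leq_divRL.
Qed.

Lemma prefix_num_digit b x k i : (forall i, (x i < b)%N) -> (0 < i <= k)%N ->
  ((prefix_num b x k %/ b ^ (k - i)) %% b)%N = x i.
Proof.
move=> xb /andP[i0 ik]; rewrite prefix_num_div//.
by case: i i0 ik => // i _ _ /=; rewrite mulnC modnMDl modn_small.
Qed.

Lemma eq_prefix_num b x x' k l : (k <= l)%N ->
  prefix_num b x k = prefix_num b x' k ->
  (forall i, (k < i <= l)%N -> x i = x' i) ->
  prefix_num b x l = prefix_num b x' l.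
Proof.
move=> kl E; elim: l kl => [|l IH]; first by rewrite leqn0 => /eqP <-.
rewrite leq_eqVlt => /orP[/eqP <-//|kl] h /=; rewrite IH ?h ?kl//=.
by move=> i /andP[ki il]; apply: h; rewrite ki ltnW.
Qed.

(** Digits are numbered from 1, the most significant one, as in
[digit_series]; [k] is the length of the expansion. *)
Definition nat_digit (b k i : nat) (j : nat) := ((i %/ b ^ (k - j)) %% b)%N.

Lemma prefix_nat_digit b k i j : (j <= k)%N ->
  prefix_num b (nat_digit b k i) j = ((i %/ b ^ (k - j)) %% b ^ j)%N.
Proof.
elim: j => [|j IH] jk /=; first by rewrite expn0 modn1.
rewrite IH; last exact: ltnW.
rewrite /nat_digit.
have -> : (k - j = (k - j.+1).+1)%N by lia.
rewrite expnSr divnMA; set a := (i %/ _)%N.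
case: (posnP b) => [->|b0]; first by rewrite !modn0 divn0 mul0n add0n exp0n// modn0.
rewrite expnS; have bj0 : (0 < b ^ j)%N by rewrite expn_gt0 b0.
have lt_c : ((a %/ b) %% b ^ j * b + a %% b < b ^ j * b)%N.
  apply: leq_trans (_ : ((a %/ b) %% b ^ j).+1 * b <= _)%N;
    last by rewrite leq_mul2r ltn_pmod ?orbT.
  by rewrite mulSn addnC ltn_add2r ltn_pmod.
rewrite [RHS](_ : _ = ((a %/ b %/ b ^ j) * (b ^ j * b) + ((a %/ b) %% b ^ j * b +
  a %% b)) %% (b ^ j * b))%N.
  by rewrite modnMDl (modn_small lt_c) mulnC.
by rewrite addnA mulnA -mulnDl -!divn_eq [(b * _)%N]mulnC.
Qed.

Lemma prefix_nat_digit_full b k i : (i < b ^ k)%N ->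
  prefix_num b (nat_digit b k i) k = i.
Proof. by move=> ik; rewrite prefix_nat_digit// subnn expn0 divn1 modn_small. Qed.

Section digit_series.
Variables (R : realType) (b : nat).
Hypothesis b2 : (1 < b)%N.

Let bX0 k : 0 < (b%:R ^+ k : R).
Proof. by rewrite exprn_gt0// ltr0n ltnW. Qed.

Lemma digit_partial_sum (x : nat -> nat) k :
  \sum_(1 <= i < k.+1) ((x i)%:R / b%:R ^+ i : R) = (prefix_num b x k)%:R / b%:R
    ^+ k.
Proof.
elim: k => [|k IH]; first by rewrite big_geq// mul0r.
rewrite big_nat_recr//= IH natrD natrM exprS.
have h : (b%:R : R) != 0 by rewrite pnatr_eq0; lia.
have h2 := lt0r_neq0 (bX0 k).
by field; rewrite h h2.
Qed.

Lemma digit_partial_sum_le (x : nat -> nat) k N : (forall i, (x i < b)%N) ->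
  \sum_(1 <= i < N) ((x i)%:R / b%:R ^+ i : R) <= (prefix_num b x k).+1%:R / b%:R
    ^+ k.
Proof.
move=> xb.
have main j : (k <= j)%N -> \sum_(1 <= i < j.+1) ((x i)%:R / b%:R ^+ i : R) <=
    (prefix_num b x k).+1%:R / b%:R ^+ k.
  move=> kj; rewrite digit_partial_sum ler_pdivrMr// mulrAC ler_pdivlMr//.
  have := prefix_numD k (j - k) xb; rewrite subnKC// => /andP[_ h].
  rewrite -[j in X in _ <= X](subnK kj) exprD mulrA ler_pM2r//.
  by rewrite -!natrX -natrM ler_nat ltnW.
case: (leqP k.+1 N) => [|kN]; first by case: N => // N; exact: main.
apply: le_trans (main k (leqnn k)).
case: N kN => [|N] kN.
  by rewrite big_geq// sumr_ge0// => i _; rewrite divr_ge0.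
have kN' := ltnW kN; rewrite [leRHS](@big_cat_nat _ _ _ N.+1)//= lerDl sumr_ge0//
  => i _; rewrite divr_ge0.
Qed.

Lemma cvg_digit_series (x : nat -> nat) : (forall i, (x i < b)%N) ->
  cvgn (fun N => \sum_(1 <= i < N) ((x i)%:R / b%:R ^+ i : R)).
Proof.
move=> xb; apply: nondecreasing_is_cvgn.
  apply/nondecreasing_seqP => N; case: N => [|N]; first by rewrite !big_geq.
  by rewrite [leRHS]big_nat_recr//= lerDl divr_ge0.
by exists ((prefix_num b x 0).+1%:R / b%:R ^+ 0) => _ [N _ <-];
  exact: digit_partial_sum_le.
Qed.

Lemma digit_series_ge (x : nat -> nat) k : (forall i, (x i < b)%N) ->
  (prefix_num b x k)%:R <= b%:R ^+ k * digit_series R b x.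
Proof.
move=> xb; rewrite mulrC -ler_pdivrMr// -digit_partial_sum.
apply: nondecreasing_cvgn_le (cvg_digit_series xb) _ => //.
apply/nondecreasing_seqP => N; case: N => [|N]; first by rewrite !big_geq.
by rewrite [leRHS]big_nat_recr//= lerDl divr_ge0.
Qed.

Lemma digit_series_le (x : nat -> nat) k : (forall i, (x i < b)%N) ->
  b%:R ^+ k * digit_series R b x <= (prefix_num b x k)%:R + 1.
Proof.
move=> xb; rewrite mulrC -ler_pdivlMr//; apply: limr_le;
  first exact: cvg_digit_series.
by near=> N; rewrite natr1; exact: digit_partial_sum_le.
Unshelve. all: by end_near. Qed.

(** Equal tails cancel exactly, so the difference carries no rounding error;
this is what makes points of the carpet with prescribed digits form an exact
arithmetic progression. *)
Lemma digit_seriesB (x x' : nat -> nat) k :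
  (forall i, (x i < b)%N) -> (forall i, (x' i < b)%N) ->
  (forall i, (k < i)%N -> x i = x' i) ->
  b%:R ^+ k * (digit_series R b x - digit_series R b x') =
  (prefix_num b x k)%:R - (prefix_num b x' k)%:R.
Proof.
move=> xb xb' tl.
have bne := lt0r_neq0 (bX0 k).
rewrite /digit_series -limB; [|exact: cvg_digit_series..].
rewrite [limn _](_ : _ = ((prefix_num b x k)%:R - (prefix_num b x' k)%:R) / b%:R
  ^+ k).
  by rewrite mulrC divfK.
apply: lim_near_cst => //.
near=> N; have kN : (k < N)%N by near: N; exact: nbhs_infty_gt.
rewrite mulrBl -!digit_partial_sum /=.
rewrite fctE /=.
rewrite (@big_cat_nat _ _ _ k.+1 1 N)//= [in X in _ - X](@big_cat_nat _ _ _ k.+1 1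
  N)//=.
rewrite opprD addrACA [X in _ + X](_ : _ = 0) ?addr0//.
apply/eqP; rewrite subr_eq0; apply/eqP; apply: eq_big_nat => i /andP[ki _].
by rewrite tl.
Unshelve. all: by end_near. Qed.
End digit_series.

Section digit_series_compare.
Variables (R : realType) (b : nat).
Hypothesis b2 : (1 < b)%N.
Variables (x x' : nat -> nat).
Hypotheses (xb : forall i, (x i < b)%N) (xb' : forall i, (x' i < b)%N).

(** The error term 1 absorbs the choice between the two expansions that a
number may have, so that uniqueness of expansions never matters. *)
Lemma prefix_num_near k :
  (prefix_num b x k)%:R - (prefix_num b x' k)%:R <=
  b%:R ^+ k * `|digit_series R b x - digit_series R b x'| + 1.
Proof.
have h1 := digit_series_ge R b2 k xb; have h2 := digit_series_le R b2 k xb'.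
have : b%:R ^+ k * (digit_series R b x - digit_series R b x') <=
  b%:R ^+ k * `|digit_series R b x - digit_series R b x'|.
  by rewrite ler_wpM2l ?exprn_ge0// ler_norm.
lra.
Qed.

Lemma digit_series_near k :
  b%:R ^+ k * `|digit_series R b x - digit_series R b x'| <=
  `|(prefix_num b x k)%:R - (prefix_num b x' k)%:R| + 1.
Proof.
have h1 := digit_series_ge R b2 k xb; have h2 := digit_series_le R b2 k xb'.
have h1' := digit_series_ge R b2 k xb'; have h2' := digit_series_le R b2 k xb.
have -> : (b%:R ^+ k : R) = `|b%:R ^+ k| by rewrite ger0_norm ?exprn_ge0.
rewrite -normrM mulrBr.
move: (_ * _) (_ * _) h1 h2 h1' h2' => u v h1 h2 h1' h2'.
set p : R := (_)%:R in h1 h2 h1' h2' *; set q : R := (_)%:R in h1 h2 h1' h2' *.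
rewrite ler_norml; have := ler_norm (p - q); have := ler_norm (q - p).
rewrite distrC; lra.
Qed.

End digit_series_compare.

(** * Gauges on the half-line *)

Lemma continuous_ballP (R : realType) (T U : pseudoMetricType R) (f : T -> U) :
  continuous f <-> forall x (e : R), 0 < e ->
    exists2 d, 0 < d & forall y, ball x d y -> ball (f x) e (f y).
Proof.
split=> [cf x e e0|H x].
  have /cvg_ballP/(_ e e0) := cf x.
  by rewrite -nbhs_ballE => -[d /= d0 h]; exists d => // y /h.
apply/cvg_ballP => e e0; have [d d0 h] := H x e e0.
by apply/nbhs_ballP; exists d.
Qed.

Section half_line.
Variable R : realType.
Local Notation half := (@half_line R).

Lemma half_ge0 (u : half) : 0 <= set_val u.
Proof. by have := set_valP u; rewrite /half_line/= in_itv/= andbT. Qed.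

Lemma to_half_subproof (t : R) : Num.max 0 t \in half.
Proof. by rewrite inE /half_line/= in_itv/= andbT le_max lexx. Qed.

Definition to_half (t : R) : half := SigSub (to_half_subproof t).

Lemma val_to_half t : 0 <= t -> set_val (to_half t) = t.
Proof. by move=> t0; rewrite /to_half /= set_valE /= max_r. Qed.

Lemma to_halfK (u : half) : to_half (set_val u) = u.
Proof. by apply: val_inj; rewrite -set_valE val_to_half// half_ge0. Qed.

Lemma half_ballE (u v : half) e : ball u e v = (`|set_val u - set_val v| < e).
Proof. by rewrite -initial_ballE. Qed.

Lemma continuous_to_half : continuous to_half.
Proof.
apply/continuous_ballP => x e e0; exists e => // y; rewrite half_ballE.
rewrite -ball_normE /= => xy; rewrite !set_valE /=.
apply: le_lt_trans xy; move: x y;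
  suff H (x y : R) : `|Num.max 0 x - Num.max 0 y| <= `|x - y| by exact: H.
have := ler_norm (x - y); have := ler_norm (y - x).
rewrite [X in _ <= X -> _]distrC ler_norml /Num.max.
by case: (ltP 0 x); case: (ltP 0 y) => ? ? ? ?; apply/andP; split; lra.
Qed.

(** Extending a gauge by its value at 0 makes it a function on the whole line,
where the intermediate and extreme value theorems apply. *)
Definition extend_half (eta : half -> half) (t : R) : R := set_val (eta (to_half
  t)).

Lemma continuous_extend_half eta : continuous eta -> continuous (extend_half eta).
Proof.
move=> ce x; apply: (@continuous_comp _ _ _ to_half (fun u => set_val (eta u))).
  exact: continuous_to_half.
apply: (@continuous_comp _ _ _ eta (fun u : half => (set_val u : R)));
  first exact: ce.
exact: initial_continuous.
Qed.

Lemma homeo_bounded (eta : half -> half) (L : R) : homeomorphism eta ->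
  exists K : R, forall u : half, set_val u <= L -> set_val (eta u) <= K.
Proof.
case=> g [_ _ ce _]; case: (lerP 0 L) => [L0|L0]; last first.
  by exists 0 => u uL; have := half_ge0 u; lra.
have [|c _ h] := @EVT_max R (extend_half eta) 0 L L0.
  exact/continuous_subspaceT/continuous_extend_half.
exists (extend_half eta c) => u uL; rewrite -{1}(to_halfK u); apply: h.
by rewrite in_itv/= half_ge0.
Qed.

(** If 0 were attained only at some [z > 0], the gauge would be positive on
both sides of [z], and small positive values would be attained on both sides,
against injectivity. *)
Lemma homeo_half0 (eta : half -> half) : homeomorphism eta ->
  set_val (eta (to_half 0)) = 0.
Proof.
move=> [g [ek gk ce _]]; set z := set_val (g (to_half 0)).
have z0 : 0 <= z := half_ge0 _.
have ez : extend_half eta z = 0 by rewrite /extend_half to_halfK gk val_to_half.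
case: (eqVneq z 0) => [z00|zn0]; first by rewrite -{2}ez z00.
have zp : 0 < z by rewrite lt_neqAle eq_sym zn0.
have inj s t : 0 <= s -> 0 <= t -> extend_half eta s = extend_half eta t -> s = t.
  move=> s0 t0 /val_inj /(can_inj ek) /(congr1 set_val).
  by rewrite !val_to_half.
have pos s : 0 <= s -> s != z -> 0 < extend_half eta s.
  move=> s0 sz; rewrite lt_neqAle half_ge0 andbT -ez.
  by apply/eqP => /inj h; move: sz; rewrite -h ?eqxx.
have p0 : 0 < extend_half eta 0 by apply: pos => //; rewrite eq_sym.
have p1 : 0 < extend_half eta (z + 1) by apply: pos; [lra|apply/eqP; lra].
pose v := Num.min (extend_half eta 0) (extend_half eta (z + 1)).
have v0 : 0 < v by rewrite /v lt_min p0.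
have cw a b : {within `[a, b], continuous (extend_half eta)}.
  exact/continuous_subspaceT/continuous_extend_half.
have [|c1] := @IVT R (extend_half eta) 0 z v z0 (cw _ _).
  rewrite ez min_r ?half_ge0// max_l ?half_ge0// ltW//=.
  by rewrite /v ge_min lexx.
rewrite in_itv/= => /andP[c10 c1z] e1.
have z01 : z <= z + 1 by lra.
have [|c2] := @IVT R (extend_half eta) z (z + 1) v z01 (cw _ _).
  rewrite ez min_l ?half_ge0// max_r ?half_ge0// ltW//=.
  by rewrite /v ge_min lexx orbT.
rewrite in_itv/= => /andP[c2z _] e2.
have E : c1 = c2 by apply: inj; [lra|lra|rewrite e1].
have cz : c1 = z by lra.
by move: v0; rewrite -e1 cz ez ltxx.
Qed.

(** Two points much closer to each other than to a third one remain so under a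
quasi-symmetry with this gauge; this makes the steps of a fine grid negligible
in the image. *)
Lemma homeo_small (eta : half -> half) (e : R) : homeomorphism eta -> 0 < e ->
  exists2 d : R, 0 < d & forall u : half, set_val u < d -> set_val (eta u) <= e.
Proof.
move=> he e0; have [g [_ _ ce _]] := he.
have /continuous_ballP/(_ (to_half 0) e e0)[d d0 h] := ce.
exists d => // u ud; have := h u; rewrite !half_ballE homeo_half0// val_to_half//.
rewrite !sub0r !normrN !ger0_norm ?half_ge0// => h'.
exact/ltW/h'.
Qed.

End half_line.

(** * Weak-type sums *)

Section weak_type_sum.
Variable R : realType.

Lemma powR_exprC (a p : R) J : 0 <= a -> (a ^+ J) `^ p = (a `^ p) ^+ J.
Proof.
by move=> a0; rewrite -powR_mulrn// -powRrM mulrC powRrM powR_mulrn ?powR_ge0.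
Qed.

Lemma powR_inv (a p : R) : 0 <= a -> a^-1 `^ p = a `^ (- p).
Proof. by move=> a0; rewrite -powR_inv1// -powRrM mulN1r. Qed.

(** The sum of the geometric series of ratio [2 `^ (beta - p)] over dyadic
levels, times the loss from rounding to a dyadic level. *)
Definition weak_const (beta p : R) : R := 2 `^ beta / (1 - 2 `^ (beta - p)).

Lemma pow2_lt1 (beta p : R) : beta < p -> 2 `^ (beta - p) < 1.
Proof.
move=> bp; rewrite -[ltRHS](powRr0 2) /powR !pnatr_eq0/= ltr_expR mul0r.
by rewrite nmulr_rlt0 ?ln_gt0 ?ltr1n//; lra.
Qed.

Lemma weak_const_gt0 (beta p : R) : beta < p -> 0 < weak_const beta p.
Proof.
by move=> bp; rewrite divr_gt0 ?powR_gt0// subr_gt0 pow2_lt1.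
Qed.

(** A weak-type bound of exponent [beta] gives a strong bound for every larger
exponent [p]: the terms between [E / 2 ^ (J + 1)] and [E / 2 ^ J] contribute at
most a multiple of the [J]-th power of [2 `^ (beta - p) < 1]. *)
Lemma sum_powR_weak (I : finType) (d : I -> R) (beta p E B : R) :
  0 < p -> beta < p -> 0 < E -> 0 <= B ->
  (forall i, 0 <= d i <= E) ->
  (forall tau, 0 < tau -> tau <= E ->
     #|[pred i | tau <= d i]|%:R * tau `^ beta <= B) ->
  \sum_i d i `^ p <= B * weak_const beta p * E `^ (p - beta).
Proof.
move=> p0 bp E0 B0 dE count; set x := 2 `^ (beta - p).
have x1 : x < 1 := pow2_lt1 bp.
have x0 : 0 <= x by rewrite powR_ge0.
have P2 J : 0 < (2 ^+ J : R) by rewrite exprn_gt0.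
have step J : \sum_(i | E / 2 ^+ J < d i) d i `^ p <=
    B * weak_const beta p * E `^ (p - beta) * (1 - x ^+ J).
  elim: J => [|J IH].
    rewrite expr0 divr1 subrr mulr0 big_pred0// => i.
    by apply/negbTE; rewrite -leNgt; case/andP: (dE i).
  rewrite (bigID (fun i => E / 2 ^+ J < d i))/=.
  set tau := E / 2 ^+ J.+1.
  have tau0 : 0 < tau by rewrite divr_gt0.
  have tau_lt : tau <= E / 2 ^+ J.
    by rewrite ler_pM2l// lef_pV2 ?posrE// ler_weXn2l// ler1n.
  have tauE : tau <= E.
    rewrite ler_pdivrMr// ler_peMr//; first exact: ltW.
    by rewrite exprn_ege1// ler1n.
  have -> : \sum_(i | (tau < d i) && (E / 2 ^+ J < d i)) d i `^ p =
            \sum_(i | E / 2 ^+ J < d i) d i `^ p.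
    apply: eq_bigl => i; case: (ltP (E / 2 ^+ J) (d i)) => h;
      rewrite ?andbF// andbT.
    exact: le_lt_trans h.
  have -> : B * weak_const beta p * E `^ (p - beta) * (1 - x ^+ J.+1) =
    B * weak_const beta p * E `^ (p - beta) * (1 - x ^+ J) +
    B * 2 `^ beta * E `^ (p - beta) * x ^+ J.
    rewrite /weak_const -/x exprS;
      have : 1 - x != 0 by rewrite subr_eq0 eq_sym lt_eqF.
    by move=> h; field.
  apply: lerD => //.
  apply: (@le_trans _ _ (\sum_(i | tau <= d i) (E / 2 ^+ J) `^ p)).
    rewrite [leRHS](bigID (fun i => (tau < d i) && ~~ (E / 2 ^+ J < d i)))/=.
    rewrite -[leLHS]addr0 lerD//; last by rewrite sumr_ge0// => *; rewrite powR_ge0.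
    rewrite [leRHS](eq_bigl (fun i => (tau < d i) && ~~ (E / 2 ^+ J < d i)));
      last first.
      by move=> i /=; case: ltP => //= h; rewrite ?andbF// (ltW h).
    apply: ler_sum => i /andP[_]; rewrite -leNgt => h.
    have /andP[di0 _] := dE i.
    by apply: ge0_ler_powR => //; rewrite ?nnegrE ?(le_trans _ h)// ltW.
  rewrite sumr_const -[leLHS]mulr_natl.
  have := count tau tau0 tauE.
  set n := (#|_|%:R : R); rewrite -ler_pdivlMr ?powR_gt0// => h.
  apply: (@le_trans _ _ (B / tau `^ beta * (E / 2 ^+ J) `^ p)).
    by apply: ler_wpM2r; rewrite ?powR_ge0.
  rewrite le_eqVlt; apply/orP; left; apply/eqP.
  have e0 : 0 < E / 2 ^+ J by rewrite divr_gt0.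
  have eE : (E / 2 ^+ J) `^ beta = 2 `^ beta * tau `^ beta.
    rewrite -powRM ?(ltW tau0)//; congr (_ `^ _).
    by rewrite /tau exprS; field; rewrite lt0r_neq0.
  have -> : (E / 2 ^+ J) `^ p = (E / 2 ^+ J) `^ (p - beta) * (E / 2 ^+ J) `^ beta.
    by rewrite -powRD ?subrK// (lt0r_neq0 e0) implybT.
  have -> : (E / 2 ^+ J) `^ (p - beta) = E `^ (p - beta) * x ^+ J.
    rewrite powRM ?invr_ge0 ?ltW// -exprVn powR_exprC ?invr_ge0//.
    by rewrite powR_inv// opprB.
  by rewrite eE; field; rewrite lt0r_neq0// powR_gt0.
have [J hJ] : exists J, forall i, 0 < d i -> E / 2 ^+ J < d i.
  have /choice[f hf] : forall i, exists J, 0 < d i -> E / 2 ^+ J < d i.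
    move=> i; case: (ltP 0 (d i)) => [di|_]; last by exists 0%N.
    exists (Num.truncn (E / d i)).+1 => _.
    rewrite ltr_pdivrMr// mulrC -ltr_pdivrMr//; apply: lt_trans (truncnS_gt _) _.
    by rewrite -natrX ltr_nat ltn_expl.
  exists (\max_i f i)%N => i di; apply: le_lt_trans (hf i di).
  rewrite ler_pM2l// lef_pV2 ?posrE// ler_weXn2l// ?ler1n//.
  exact: leq_bigmax.
apply: (@le_trans _ _ (\sum_(i | E / 2 ^+ J < d i) d i `^ p)).
  rewrite (bigID (fun i => E / 2 ^+ J < d i))/= -[leRHS]addr0 lerD//.
  rewrite big1// => i; rewrite -leNgt => h; case: (ltP 0 (d i)) => [/hJ|di].
    by rewrite ltNge h.
  have -> : d i = 0 by apply/eqP; rewrite eq_le di; case/andP: (dE i).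
  by rewrite powR0// lt0r_neq0.
apply: le_trans (step J) _; rewrite ler_piMr//.
  by apply: mulr_ge0; [apply: mulr_ge0 => //;
    exact/ltW/weak_const_gt0 | exact: powR_ge0].
by rewrite gerBl exprn_ge0.
Qed.
End weak_type_sum.

(** * A length-volume inequality *)

Section metric_counting.
Context {R : realType} {Y : metricType R}.

(** Each ball of radius [r] contains at most one of the points. *)
Lemma card_separated (I : finType) (A : {pred I}) (F : I -> Y) (r : R) (s : seq Y) :
  (forall i, i \in A -> exists2 y, y \in s & mdist y (F i) < r) ->
  {in A &, forall i j, i != j -> 2 * r <= mdist (F i) (F j)} ->
  (#|A| <= size s)%N.
Proof.
move=> cov sep.
have /choice[f fP] : forall i, exists k : nat, i \in A ->
    (k < size s)%N /\ forall y0, mdist (nth y0 s k) (F i) < r.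
  move=> i; case: (boolP (i \in A)) => [iA|]; last by exists 0%N.
  have [y ys yr] := cov i iA; exists (index y s) => _; split;
    first by rewrite index_mem.
  by move=> y0; rewrite nth_index.
have finj : {in A &, injective f}.
  move=> i j iA jA eqf; apply/eqP/negPn/negP => ij.
  have [_ /(_ (F i)) h1] := fP i iA; have [_ /(_ (F i)) h2] := fP j jA.
  have := metric_triangle (F i) (nth (F i) s (f j)) (F j).
  by have := sep i j iA jA ij; rewrite eqf metric_sym in h1; lra.
rewrite cardE -(size_map f) -(size_iota 0 (size s)).
apply: uniq_leq_size.
  by rewrite map_inj_in_uniq ?enum_uniq// => i j; rewrite !mem_enum; exact: finj.
move=> x /mapP[i]; rewrite mem_enum => /fP[h _] ->.
by rewrite mem_iota add0n h.
Qed.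

Lemma mdist_chain (u : nat -> Y) (n : nat) :
  mdist (u 0%N) (u n) <= \sum_(i < n) mdist (u i) (u i.+1).
Proof.
elim: n => [|n IH]; first by rewrite mdistxx big_ord0.
rewrite big_ord_recr/=; apply: le_trans (metric_triangle _ (u n) _) _.
exact: lerD.
Qed.

Lemma le_diam (x y : Y) (d : R) : d <= mdist x y -> (d%:E <= diam Y)%E.
Proof.
move=> h; apply: (@le_trans _ _ (mdist x y)%:E); first by rewrite lee_fin.
by apply: ereal_sup_ubound; exists x, y.
Qed.

End metric_counting.

(** The factors come from [grid_sum_bound]: the lower bound for the sum, the
covering constant, the dyadic sum, the counting of large steps, and the bound
on the largest step. *)
Definition grid_const (R : realType) (K C0 beta p : R) : R :=
  (4 * K) `^ p * C0 * weak_const beta p * (4 * K ^+ 2) `^ beta *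
  (2 * K) `^ (p - beta).

(** Compare two bounds of the sum of the [(1+q)]-th powers of the steps.
Above: points followed by a step of length at least [tau] are [tau / K]
separated, so the covering hypothesis bounds their number, and
[sum_powR_weak] applies.  Below: steps shorter than [Delta / (4 * K * N)] make
up at most half of the total length [#|I| * Delta / (2 * K)]; on the others
[d `^ (1 + q)] is at least [d] times the [q]-th power of that threshold.  The
powers of [Delta] cancel, and [#|I| >= c * N `^ q] removes [N]. *)
Lemma grid_sum_bound (R : realType) (Y : metricType R) (beta C0 K eps q c : R)
    (N : nat) (I : finType) (F : nat -> I -> Y) (k0 : I) :
  let Delta := mdist (F 0%N k0) (F N k0) in
  0 < beta -> 0 <= q -> beta < 1 + q -> 1 <= K -> 0 < eps -> eps <= 1 -> 0 < C0 ->
  (forall r r' : R, 0 < r -> r <= r' / 2 -> ((r' / 2)%:E <= diam Y)%E ->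
    forall x : Y, exists s : seq Y,
      (size s)%:R <= C0 * (r' / r) `^ beta /\
      ball x r' `<=` \bigcup_(y in [set` s]) ball y r) ->
  (0 < N)%N -> 0 < Delta -> c * N%:R `^ q <= #|I|%:R ->
  (forall i k, (i <= N)%N -> mdist (F 0%N k0) (F i k) <= K * Delta) ->
  (forall k, Delta <= 2 * K * mdist (F 0%N k) (F N k)) ->
  (forall i k, (i < N)%N -> mdist (F i k) (F i.+1 k) <= 2 * K * eps * Delta) ->
  (forall i j k l, (i < N)%N -> (j <= N)%N -> (i, k) != (j, l) ->
    mdist (F i k) (F i.+1 k) <= K * mdist (F i k) (F j l)) ->
  c <= grid_const K C0 beta (1 + q) * eps `^ (1 + q - beta).
Proof.
move=> Delta beta0 q0 bq K1 eps0 eps1 C00 cov N0 D0 cI hdiam hend hsmall hsep.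
have K0 : 0 < K by lra.
pose d (x : 'I_N * I) := mdist (F x.1 x.2) (F x.1.+1 x.2).
set p := 1 + q; have p0 : 0 < p by rewrite /p; lra.
have up : \sum_x d x `^ p <=
    C0 * (4 * K ^+ 2 * Delta) `^ beta * weak_const beta p *
      (2 * K * eps * Delta) `^ (p - beta).
  apply: sum_powR_weak => //.
  - by rewrite !mulr_gt0.
  - by rewrite mulr_ge0 ?powR_ge0 ?ltW.
  - by move=> [i k]; rewrite mdist_ge0/= hsmall.
  move=> tau tau0 tauE.
  pose G (x : 'I_N.+1 * I) := mdist (F 0%N k0) (F x.1 x.2).
  pose xm := [arg max_(x > (ord_max, k0)) G x]%O.
  have xmP x : G x <= G xm by rewrite /xm; case: arg_maxP => //= y _; apply.
  have GD : Delta <= G xm by exact: (xmP (ord_max, k0)).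
  have GK : G xm <= K * Delta by apply: hdiam; rewrite -ltnS.
  have G2 : 2 * G xm / 2 = G xm by field.
  have r0 : 0 < tau / (2 * K) by rewrite divr_gt0// mulr_gt0.
  have rG : tau / (2 * K) <= (2 * G xm) / 2.
    rewrite G2; apply: le_trans GD; rewrite ler_pdivrMr ?mulr_gt0//.
    apply: le_trans tauE _; rewrite [leRHS]mulrC ler_pM2r//.
    by rewrite ler_piMr// mulr_ge0// ltW.
  have [|s [sC sub]] := cov (tau / (2 * K)) (2 * G xm) r0 rG _ (F 0%N k0).
    by rewrite G2; exact: (le_diam (lexx _)).
  have cs : (#|[pred i | (tau <= d i)%R]| <= size s)%N.
    apply: (@card_separated _ _ _ _ (fun x : 'I_N * I => F x.1 x.2) (tau / (2 *
      K))).
      move=> x _; have : ball (F 0%N k0) (2 * G xm) (F x.1 x.2).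
        have := xmP (widen_ord (leqnSn N) x.1, x.2); rewrite ballEmdist/= /G/=.
        by move=> h; apply: le_lt_trans h _; have := D0; move: GD; rewrite /G/=;
          lra.
      by move=> /sub[y /= ys]; rewrite ballEmdist/= => h; exists y.
    move=> [i k] [j l]; rewrite !inE => h1 h2 ne.
    rewrite [leLHS](_ : _ = tau / K); last by field; rewrite lt0r_neq0.
    rewrite ler_pdivrMr// [leRHS]mulrC; apply: le_trans h1 _.
    apply: hsep => //=; first exact: ltnW.
  apply: (@le_trans _ _ (C0 * (2 * G xm / (tau / (2 * K))) `^ beta * tau `^ beta)).
    apply: ler_wpM2r; first exact: powR_ge0.
    by apply: le_trans sC; rewrite ler_nat.
  rewrite -mulrA ler_wpM2l ?(ltW C00)//.
  rewrite -powRM; [|by apply: divr_ge0;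
    [rewrite mulr_ge0 ?mdist_ge0|exact: ltW]|exact: ltW].
  have -> : 2 * G xm / (tau / (2 * K)) * tau = 4 * K * G xm.
    by field; rewrite !lt0r_neq0.
  apply: ge0_ler_powR; rewrite ?nnegrE ?mulr_ge0 ?mdist_ge0 ?exprn_ge0 ?(ltW K0)
    ?(ltW beta0) ?(ltW D0)//.
  have : 4 * K * G xm <= 4 * K * (K * Delta) by rewrite ler_pM2l// mulr_gt0.
  by rewrite expr2; lra.
(* Below this threshold, [N * #|I|] steps add up to half of the total length. *)
set tau := Delta / (4 * K * N%:R).
have NR0 : 0 < (N%:R : R) by rewrite ltr0n.
have tau0 : 0 < tau by rewrite divr_gt0// !mulr_gt0.
have tq0 : 0 < tau `^ q by exact: powR_gt0.
have lo1 x : tau `^ q * d x <= tau `^ q * tau + d x `^ p.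
  case: (lerP (d x) tau) => h.
    apply: le_trans (_ : tau `^ q * tau <= _); first by rewrite ler_pM2l.
    by rewrite lerDl powR_ge0.
  have dx0 : 0 < d x := lt_trans tau0 h.
  apply: le_trans (_ : d x `^ p <= _); last by rewrite lerDr mulr_ge0 ?ltW.
  rewrite /p powRD; last by rewrite (lt0r_neq0 dx0) implybT.
  rewrite powRr1 ?(ltW dx0)// [leRHS]mulrC ler_pM2r//.
  by apply: ge0_ler_powR => //; rewrite ?nnegrE ltW.
have lo2 : #|I|%:R * (Delta / (2 * K)) <= \sum_x d x.
  have -> : \sum_x d x = \sum_k \sum_(i < N) mdist (F i k) (F i.+1 k).
    by rewrite exchange_big/= pair_bigA.
  rewrite mulr_natl -sumr_const; apply: ler_sum => k _.
  apply: le_trans (mdist_chain (F^~ k) N).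
  by rewrite ler_pdivrMr ?mulr_gt0// mulrC.
have lo3 : tau `^ q * \sum_x d x <= N%:R * #|I|%:R * (tau `^ q * tau) + \sum_x d x
  `^ p.
  rewrite mulr_sumr -natrM.
  have -> : (N * #|I|)%N = #|{: 'I_N * I}| by rewrite card_prod card_ord.
  by rewrite mulr_natl -sumr_const -big_split/=; apply: ler_sum.
have lo4 : c * (Delta / (4 * K)) `^ p <= \sum_x d x `^ p.
  have e1 : N%:R * #|I|%:R * (tau `^ q * tau) = tau `^ q * (#|I|%:R * (Delta / (4
    * K))).
    by rewrite /tau; field; rewrite !lt0r_neq0.
  have e2 : tau `^ q * (#|I|%:R * (Delta / (2 * K))) <= tau `^ q * \sum_x d x.
    by rewrite ler_pM2l.
  have e3 : tau `^ q * (#|I|%:R * (Delta / (2 * K))) =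
      2 * (tau `^ q * (#|I|%:R * (Delta / (4 * K)))).
    by field; rewrite lt0r_neq0.
  have e4 : tau `^ q * (#|I|%:R * (Delta / (4 * K))) <= \sum_x d x `^ p by lra.
  apply: le_trans e4.
  have DK0 : 0 < Delta / (4 * K) by rewrite divr_gt0// mulr_gt0.
  rewrite /p powRD; last by rewrite (lt0r_neq0 DK0) implybT.
  rewrite powRr1 ?(ltW DK0)//.
  have -> : (Delta / (4 * K)) `^ q = tau `^ q * N%:R `^ q.
    rewrite -powRM ?(ltW tau0) ?(ltW NR0)//; congr (_ `^ _).
    by rewrite /tau; field; rewrite !lt0r_neq0.
  rewrite [leLHS](_ : _ = tau `^ q * (Delta / (4 * K)) * (c * N%:R `^ q));
    last by ring.
  by rewrite [in leRHS]mulrCA [leRHS]mulrC; apply: ler_wpM2l => //;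
    rewrite mulr_ge0 ?ltW.
have := le_trans lo4 up; rewrite /grid_const -/p => H.
have Dp : 0 < Delta `^ p by exact: powR_gt0.
rewrite -(ler_pM2r Dp).
have E1 : Delta `^ p = Delta `^ beta * Delta `^ (p - beta).
  by rewrite -{1}(subrK beta p) powRD ?(lt0r_neq0 D0) ?implybT// mulrC.
have E2 : Delta `^ p = (4 * K) `^ p * (Delta / (4 * K)) `^ p.
  rewrite -powRM; [|by rewrite mulr_ge0// ltW|by rewrite divr_ge0 ?mulr_ge0 ?(ltW
    K0) ?(ltW D0)].
  by congr (_ `^ _); field; rewrite lt0r_neq0.
rewrite {1}E2 mulrCA.
have : (4 * K) `^ p * (c * (Delta / (4 * K)) `^ p) <= (4 * K) `^ p *
    (C0 * (4 * K ^+ 2 * Delta) `^ beta * weak_const beta p *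
      (2 * K * eps * Delta) `^ (p - beta)).
  by apply: ler_wpM2l => //; exact: powR_ge0.
move=> /le_trans; apply; rewrite E1.
rewrite !(@powRM _ _ Delta) ?mulr_ge0 ?exprn_ge0 ?(ltW D0) ?(ltW K0) ?(ltW eps0)//.
rewrite (@powRM _ _ eps) ?mulr_ge0 ?(ltW K0) ?(ltW eps0)//.
rewrite le_eqVlt; apply/orP; left; apply/eqP; ring.
Qed.

(** * Quasi-symmetric images of grids *)

(** A discrete form of a product of a segment with a [q]-dimensional set: [I]
indexes the fibres, each of which is crossed in [N] steps of length about
[lam], and the points are separated at the scale of the steps. *)
Definition has_grids (R : realType) (X : metricType R) (L c q : R) :=
  forall N0 : nat, exists (N : nat) (I : finType) (p : nat -> I -> X) (lam : R),
  [/\ (N0 <= N)%N, 0 < lam, c * N%:R `^ q <= #|I|%:R &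
  [/\ forall i k, (i < N)%N -> mdist (p i k) (p i.+1 k) <= L * lam,
      forall i j k l, (i <= N)%N -> (j <= N)%N -> (i, k) != (j, l) ->
        lam <= L * mdist (p i k) (p j l),
      forall i j k l, (i <= N)%N -> (j <= N)%N ->
        mdist (p i k) (p j l) <= L * N%:R * lam
    & forall k, N%:R * lam <= L * mdist (p 0%N k) (p N k)]].

(** A bound for the gauge on an initial segment is all that is used of a
quasi-symmetry: once with a fixed ratio and a constant [K], once with a small
ratio and a small constant. *)
Lemma quasisymmetric_le (R : realType) (X Y : metricType R) (f : X -> Y)
    (eta : @half_line R -> @half_line R) (T K : R) :
  homeomorphism f ->
  (forall x a b : X, x <> b ->
    mdist (f x) (f a) / mdist (f x) (f b) <= \val (eta (dist_ratio x a b))) ->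
  (forall u : half_line, set_val u <= T -> set_val (eta u) <= K) ->
  forall x a b, x <> b -> mdist x a <= T * mdist x b ->
    mdist (f x) (f a) <= K * mdist (f x) (f b).
Proof.
move=> [g [fg _ _ _]] qs hT x a b xb h.
have d0 : 0 < mdist x b by rewrite mdist_gt0; apply/eqP.
have e0 : 0 < mdist (f x) (f b) by rewrite mdist_gt0; apply/eqP => /(can_inj fg).
rewrite -ler_pdivrMr//; apply: le_trans (qs x a b xb) _.
by apply: (hT (dist_ratio x a b)); rewrite set_valE/= ler_pdivrMr.
Qed.

(** In a grid with [N] large, one of the two ends of a fibre lies at distance
about [N * lam] from a given point, so its step is short in proportion and is
mapped to a step of length at most [eps * Delta].  Since [eps] is arbitrary
while the constants depend on [L] only, [grid_sum_bound] is contradicted when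
[beta < 1 + q]. *)
Lemma assouad_exponent_ge_grids (R : realType) (X Y : metricType R) (f : X -> Y)
    (L c q beta : R) : 1 <= L -> 0 < c -> 0 <= q -> 0 < beta -> has_grids X L c q ->
  quasisymmetric f -> assouad_exponent Y beta -> 1 + q <= beta.
Proof.
move=> L1 c0 q0 beta0 grids [hf [eta heta qs]] [C0 C00 cov].
rewrite leNgt; apply/negP => bq.
have [K' K'P] := homeo_bounded (L ^+ 2) heta.
pose K := Num.max 1 K'.
have K1 : 1 <= K by rewrite le_max lexx.
have KP (u : half_line) : set_val u <= L ^+ 2 -> set_val (eta u) <= K.
  by move=> /K'P h; rewrite le_max h orbT.
have bigqs := quasisymmetric_le hf qs KP.
set W := grid_const K C0 beta (1 + q).
have W0 : 0 < W.
  have K0 : 0 < K by apply: lt_le_trans K1.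
  rewrite /W /grid_const.
  by do ![exact: weak_const_gt0 | exact: C00 | apply: powR_gt0 | apply: mulr_gt0 |
    exact: exprn_gt0].
have pb : 0 < 1 + q - beta by rewrite subr_gt0.
(* The choice of [eps] makes [W * eps `^ (1 + q - beta)] at most [c / 2]. *)
pose eps := Num.min 1 ((c / (2 * W)) `^ (1 + q - beta)^-1).
have cW : 0 < c / (2 * W) by rewrite divr_gt0// mulr_gt0.
have eps0 : 0 < eps by rewrite lt_min ltr01 powR_gt0.
have eps1 : eps <= 1 by rewrite ge_min lexx.
have epsW : W * eps `^ (1 + q - beta) < c.
  apply: (@le_lt_trans _ _ (W * (c / (2 * W)))).
    rewrite ler_pM2l//.
    rewrite -[leRHS]powRr1 ?(ltW cW)// -[X in _ <= _ `^ X](mulVf (lt0r_neq0 pb))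
      powRrM.
    apply: ge0_ler_powR; rewrite ?nnegrE ?powR_ge0//; first exact: ltW.
      exact: ltW.
    by rewrite ge_min lexx orbT.
  have -> : W * (c / (2 * W)) = c / 2 by field; rewrite lt0r_neq0.
  by lra.
have [d d0 dP] := homeo_small heta eps0.
pose d' := d / 2.
have dP' (u : half_line) : set_val u <= d' -> set_val (eta u) <= eps.
  by move=> h; apply: dP; rewrite /d' in h; lra.
have smallqs := quasisymmetric_le hf qs dP'.
have [N [I [p [lam [N0N lam0 cI [hstep hsep hdiam hend]]]]]] :=
  grids (Num.truncn (2 * L ^+ 2 / d')).+1.
have NN : 2 * L ^+ 2 <= d' * N%:R.
  rewrite [leRHS]mulrC -ler_pdivrMr; last by rewrite /d'; lra.
  by apply: le_trans (ltW (truncnS_gt _)) _; rewrite ler_nat.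
have N0 : (0 < N)%N by apply: leq_trans N0N.
have NR0 : 0 < (N%:R : R) by rewrite ltr0n.
have I0 : (0 < #|I|)%N.
  by rewrite -(ltr0n R); apply: lt_le_trans cI; rewrite mulr_gt0 ?powR_gt0.
have [k0 _] : exists k0 : I, k0 \in I by apply/card_gt0P.
have NL0 : 0 < N%:R * lam by rewrite mulr_gt0.
have L0 : 0 < L by lra.
have pos i j k l : (i <= N)%N -> (j <= N)%N -> (i, k) != (j, l) -> 0 < mdist (p i
  k) (p j l).
  move=> iN jN ne; have := hsep _ _ _ _ iN jN ne; have := mdist_ge0 (p i k) (p j l).
  by rewrite le_eqVlt => /orP[/eqP<-|//]; rewrite mulr0; lra.
have neq i j k l : (i <= N)%N -> (j <= N)%N -> (i, k) != (j, l) -> p i k <> p j l.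
  by move=> iN jN ne E; have := pos _ _ _ _ iN jN ne; rewrite E mdistxx ltxx.
have ends k : (0%N, k) != (N, k) by apply/eqP => -[E]; rewrite -E in N0.
have far x a k : mdist x a <= L * N%:R * lam ->
    mdist x a <= L ^+ 2 * mdist (p 0%N k) (p N k).
  move=> h; apply: le_trans h _; rewrite expr2 -!mulrA ler_pM2l//; exact: hend.
pose F i k := f (p i k).
have FK i k : (i <= N)%N -> mdist (F 0%N k0) (F i k) <= K * mdist (F 0%N k0) (F N
  k0).
  by move=> iN; apply: bigqs; [exact: neq|apply: far; exact: hdiam].
have : c <= W * eps `^ (1 + q - beta); last by rewrite leNgt epsW.
apply: (@grid_sum_bound _ Y _ _ _ _ _ _ N I F k0) => //.
- rewrite mdist_gt0; apply/eqP => E; apply: (neq 0%N N k0 k0) => //.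
  by have [g [fg _ _ _]] := hf; exact: can_inj fg _ _ E.
- move=> k; have h1 : mdist (F 0%N k) (F 0%N k0) <= K * mdist (F 0%N k) (F N k).
    by apply: bigqs; [exact: neq|apply: far; exact: hdiam].
  have h2 : mdist (F 0%N k) (F N k0) <= K * mdist (F 0%N k) (F N k).
    by apply: bigqs; [exact: neq|apply: far; exact: hdiam].
  have := metric_triangle (F 0%N k0) (F 0%N k) (F N k0); rewrite metric_sym in h1.
  by lra.
- move=> i k iN.
  have [j jN dj] : exists2 j, (j <= N)%N & N%:R * lam <= 2 * L * mdist (p i k) (p
    j k).
    have t := metric_triangle (p 0%N k) (p i k) (p N k).
    have e := hend k; rewrite (metric_sym (p 0%N k) (p i k)) in t.
    have {}t : L * mdist (p 0%N k) (p N k) <= L * (mdist (p i k) (p 0%N k) + mdist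
      (p i k) (p N k)).
      by rewrite ler_pM2l.
    case: (lerP (mdist (p i k) (p 0%N k)) (mdist (p i k) (p N k))) => h.
      exists N => //; apply: le_trans e _; apply: le_trans t _.
      by rewrite (mulrC 2) -mulrA ler_pM2l//; lra.
    exists 0%N => //; apply: le_trans e _; apply: le_trans t _.
    by rewrite (mulrC 2) -mulrA ler_pM2l//; lra.
  have pne : p i k <> p j k.
    by move=> E; move: dj; rewrite E mdistxx mulr0; lra.
  apply: le_trans (smallqs _ (p i.+1 k) (p j k) pne _) _.
    apply: le_trans (hstep _ _ iN) _.
    rewrite -(ler_pM2r NR0) mulrAC [leRHS]mulrAC.
    apply: (@le_trans _ _ (2 * L ^+ 2 * mdist (p i k) (p j k))).
      by move: dj; rewrite -(ler_pM2l L0) expr2; lra.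
    by rewrite ler_wpM2r ?mdist_ge0.
  have h1 := FK i k (ltnW iN); have h2 := FK j k jN.
  have := metric_triangle (F i k) (F 0%N k0) (F j k);
    rewrite (metric_sym (F i k) (F 0%N k0)).
  move=> h3; have h4 : mdist (F i k) (F j k) <= 2 * (K * mdist (F 0%N k0) (F N
    k0)) by lra.
  by have := ler_wpM2l (ltW eps0) h4; rewrite /F in h4 *; lra.
- move=> i j k l iN jN ne; apply: bigqs; first exact: neq (ltnW iN) jN ne.
  apply: le_trans (hstep _ _ iN) _; rewrite expr2 -mulrA ler_pM2l//.
  exact: hsep (ltnW iN) jN ne.
Qed.

(** * Chains and the ultrametric they define *)

Section covering.
Context {R : realType} (X : metricType R).

(** Unlike [assouad_exponent], radii are not limited by the diameter.  For a
bounded set this changes nothing, and it spares a comparison of diameters when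
the metric is replaced by a power of another one. *)
Definition covering_exponent (alpha : R) :=
  exists2 C : R, 0 < C &
    forall r r' : R, 0 < r -> r <= r' ->
    forall x : X, exists s : seq X,
      (size s)%:R <= C * (r' / r) `^ alpha /\
      ball x r' `<=` \bigcup_(y in [set` s]) ball y r.

Lemma covering_assouad_exponent alpha : covering_exponent alpha ->
  assouad_exponent X alpha.
Proof.
case=> C C0 H; exists C => // r r' r0 rr' _; apply: H => //; lra.
Qed.

Lemma le_covering_exponent alpha beta : alpha <= beta ->
  covering_exponent alpha -> covering_exponent beta.
Proof.
move=> ab [C C0 H]; exists C => // r r' r0 rr' x.
have [s [h1 h2]] := H r r' r0 rr' x; exists s; split=> //.
apply: le_trans h1 _; rewrite ler_pM2l//; apply: ler_powR => //.
by rewrite ler_pdivlMr// mul1r.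
Qed.

End covering.

Section chain.
Context {R : realType} {X : metricType R}.
Implicit Types (x y z : X) (e : R).

(** [y] can be reached from [x] by steps of length at most [e].  Quantifying
over the sets closed under such steps makes an invariant argument a direct
application. *)
Definition chain e x y := forall B : set X, B x ->
  (forall u v, B u -> mdist u v <= e -> B v) -> B y.

Lemma chain_step e x y : mdist x y <= e -> chain e x y.
Proof. by move=> h B Bx /(_ x y Bx h). Qed.

Lemma chain_trans e y x z : chain e x y -> chain e y z -> chain e x z.
Proof. by move=> xy yz B Bx HB; apply: (yz B) => //; apply: xy. Qed.

Lemma chain_sym e x y : chain e x y -> chain e y x.
Proof.
move=> /(_ [set u | chain e u x]) h; apply: h => [B Bx _//|u v /= ux uv].
by apply: (@chain_trans e u v x) => //; apply: chain_step; rewrite metric_sym.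
Qed.

Lemma le_chain e e' x y : e <= e' -> chain e x y -> chain e' x y.
Proof.
move=> ee' h B Bx HB; apply: h => // u v Bu uv; apply: HB Bu _; exact: le_trans ee'.
Qed.

Definition uniformly_disconnected (C : R) :=
  forall e x y, 0 < e -> chain e x y -> mdist x y <= C * e.

Definition chain_dist x y : R := inf [set e | 0 <= e /\ chain e x y].

Let chain_has_inf x y : has_inf [set e | 0 <= e /\ chain e x y].
Proof.
split; last by exists 0 => e [].
by exists (mdist x y); split; [exact: mdist_ge0|exact: chain_step].
Qed.

Lemma chain_dist_le e x y : 0 <= e -> chain e x y -> chain_dist x y <= e.
Proof. by move=> e0 h; apply: ge_inf; [case: (chain_has_inf x y)|]. Qed.

Lemma chain_dist_lt e x y : chain_dist x y < e -> 0 < e /\ chain e x y.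
Proof.
move=> h; have [|e' [e0 ch] lt] := inf_lt _ h; first by case: (chain_has_inf x y).
by split; [exact: le_lt_trans lt|apply: le_chain ch; exact: ltW].
Qed.

Lemma chain_dist_ge0 x y : 0 <= chain_dist x y.
Proof. by apply: lb_le_inf => [|e []//]; case: (chain_has_inf x y). Qed.

Lemma chain_dist_le_mdist x y : chain_dist x y <= mdist x y.
Proof. by apply: chain_dist_le; [exact: mdist_ge0|exact: chain_step]. Qed.

Lemma chain_distxx x : chain_dist x x = 0.
Proof.
by apply/eqP; rewrite eq_le chain_dist_ge0 -(mdistxx x) chain_dist_le_mdist.
Qed.

Lemma chain_dist_sym x y : chain_dist x y = chain_dist y x.
Proof.
by congr inf; apply/seteqP; split=> e /= [e0 /chain_sym h].
Qed.

(** A chain from [x] to [y] and one from [y] to [z] can be concatenated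
without increasing the largest step. *)
Lemma chain_dist_ultra y x z :
  chain_dist x z <= Num.max (chain_dist x y) (chain_dist y z).
Proof.
apply/ler_addgt0Pr => e e0; set M := Num.max _ _.
have [|p1 c1] := @chain_dist_lt (M + e) x y.
  by rewrite (@le_lt_trans _ _ M) ?ltrDl// le_max lexx.
have [|p2 c2] := @chain_dist_lt (M + e) y z.
  by rewrite (@le_lt_trans _ _ M) ?ltrDl// le_max lexx orbT.
by apply: chain_dist_le; [exact: ltW|exact: (@chain_trans _ y)].
Qed.

Lemma mdist_le_chain_dist C x y : 0 < C -> uniformly_disconnected C ->
  mdist x y <= C * chain_dist x y.
Proof.
move=> C0 ud; rewrite mulrC -ler_pdivrMr//; apply/ler_addgt0Pr => e e0.
have [|e'0 ch] := @chain_dist_lt (chain_dist x y + e) x y; first by rewrite ltrDl.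
by rewrite ler_pdivrMr// mulrC; exact: ud.
Qed.

End chain.

Arguments uniformly_disconnected {R} X C.

(** The hypotheses are parameters of the type because they are what makes the
distance below positive on distinct points. *)
Definition chain_space (R : realType) (X : metricType R) (C : R) (p : nat)
  (C0 : 0 < C) (ud : uniformly_disconnected X C) : Type := X.

Section chain_space.
Context {R : realType} (X : metricType R) (C : R) (p : nat).
Hypotheses (C0 : 0 < C) (ud : uniformly_disconnected X C).
Local Notation Y := (chain_space p C0 ud).

HB.instance Definition _ := Choice.copy Y X.

Definition snow_dist (x y : Y) : R := @chain_dist R X x y ^+ p.+1.

Lemma snow_distxx x : snow_dist x x = 0.
Proof. by rewrite /snow_dist chain_distxx expr0n. Qed.

Lemma snow_dist_positivity x y : snow_dist x y = 0 -> x = y.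
Proof.
move=> /eqP; rewrite expf_eq0/= => /eqP h.
apply: (@mdist_positivity R X); apply/eqP; rewrite eq_le mdist_ge0 andbT.
by rewrite (le_trans (mdist_le_chain_dist _ _ C0 ud))// h mulr0.
Qed.

Lemma snow_dist_sym x y : snow_dist x y = snow_dist y x.
Proof. by rewrite /snow_dist chain_dist_sym. Qed.

(** For an ultrametric the triangle inequality survives every power. *)
Lemma snow_dist_triangle y x z : snow_dist x z <= snow_dist x y + snow_dist y z.
Proof.
have h := @chain_dist_ultra R X y x z.
have [p1 p2] := (@chain_dist_ge0 R X x y, @chain_dist_ge0 R X y z).
apply: (@le_trans _ _ (Num.max (chain_dist (x : X) y) (chain_dist (y : X) z) ^+
  p.+1)).
  by apply: lerXn2r => //; rewrite nnegrE ?chain_dist_ge0// le_max chain_dist_ge0.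
by rewrite /snow_dist; case: (leP (chain_dist (x : X) y)) => _;
  rewrite ?lerDl ?lerDr exprn_ge0.
Qed.

HB.instance Definition _ := @isMetric.Build R Y snow_dist
  snow_distxx snow_dist_positivity snow_dist_sym snow_dist_triangle.

Lemma snow_distE (x y : Y) : mdist x y = @chain_dist R X x y ^+ p.+1.
Proof. by []. Qed.

Lemma snow_le (x y : X) : mdist (x : Y) (y : Y) <= mdist x y ^+ p.+1.
Proof.
by rewrite snow_distE; apply: lerXn2r;
  rewrite ?nnegrE ?chain_dist_ge0 ?mdist_ge0 ?chain_dist_le_mdist.
Qed.

Lemma snow_ge (x y : X) : mdist x y ^+ p.+1 <= C ^+ p.+1 * mdist (x : Y) (y : Y).
Proof.
rewrite snow_distE -exprMn; apply: lerXn2r;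
  rewrite ?nnegrE ?mulr_ge0 ?chain_dist_ge0 ?mdist_ge0 ?(ltW C0)//.
exact: mdist_le_chain_dist.
Qed.
End chain_space.

(** * Snowflaking a uniformly disconnected space *)

Section snowflake.
Context {R : realType}.

Lemma exprD_ge (a b : R) k : 0 <= a -> 0 <= b ->
  a ^+ k.+1 + b ^+ k.+1 <= (a + b) ^+ k.+1.
Proof.
move=> a0 b0; elim: k => [|k IH]; first by rewrite !expr1.
rewrite (exprS (a + b)); apply: (@le_trans _ _ ((a + b) * (a ^+ k.+1 + b ^+ k.+1))).
  rewrite !(exprS _ k.+1) mulrDl !mulrDr;
    have h1 : 0 <= a * b ^+ k.+1 by rewrite mulr_ge0 ?exprn_ge0.
  have h2 : 0 <= b * a ^+ k.+1 by rewrite mulr_ge0 ?exprn_ge0.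
  by lra.
by rewrite ler_wpM2l ?addr_ge0.
Qed.

(** Roots are continuous with this explicit modulus, also at 0, where they are
not differentiable. *)
Lemma dist_expr_le (a b : R) k : 0 <= a -> 0 <= b ->
  `|a - b| ^+ k.+1 <= `|a ^+ k.+1 - b ^+ k.+1|.
Proof.
wlog ab : a b / b <= a.
  move=> H a0 b0; case: (leP b a) => [|/ltW] h; first exact: H.
  by rewrite distrC (distrC (a ^+ _)) H.
move=> a0 b0; rewrite ger0_norm ?subr_ge0//.
apply: le_trans (ler_norm _).
have := exprD_ge k b0 (_ : 0 <= a - b); rewrite subr_ge0 => /(_ ab).
by rewrite addrCA subrr addr0; lra.
Qed.

Definition rootn (k : nat) (a : R) : R := a `^ (k.+1%:R)^-1.

Lemma rootn_ge0 k a : 0 <= rootn k a. Proof. exact: powR_ge0. Qed.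

Lemma rootnK k a : 0 <= a -> rootn k a ^+ k.+1 = a.
Proof.
by move=> a0; rewrite -powR_mulrn ?powR_ge0// -powRrM mulVf ?powRr1.
Qed.

Lemma exprK k a : 0 <= a -> rootn k (a ^+ k.+1) = a.
Proof.
by move=> a0; rewrite /rootn -powR_mulrn// -powRrM mulfV ?powRr1.
Qed.

Lemma lt_expr (a b : R) k : 0 <= b -> a ^+ k.+1 < b ^+ k.+1 -> a < b.
Proof.
move=> b0; rewrite !ltNge; apply: contra => h; apply: lerXn2r => //;
  rewrite nnegrE//.
exact: le_trans h.
Qed.

Section power_gauge.
Variables (C : R) (k : nat).
Hypothesis C0 : 0 < C.

Definition power_gauge (u : @half_line R) : @half_line R :=
  to_half ((C * set_val u) ^+ k.+1).

Definition power_gauge_inv (u : @half_line R) : @half_line R :=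
  to_half (rootn k (set_val u) / C).

Lemma val_power_gauge u : set_val (power_gauge u) = (C * set_val u) ^+ k.+1.
Proof. by rewrite val_to_half// exprn_ge0// mulr_ge0 ?half_ge0// ltW. Qed.

Lemma val_power_gauge_inv u : set_val (power_gauge_inv u) = rootn k (set_val u) / C.
Proof. by rewrite val_to_half// divr_ge0 ?rootn_ge0// ltW. Qed.

Lemma power_gauge_homeo : homeomorphism power_gauge.
Proof.
have Cn := lt0r_neq0 C0.
exists power_gauge_inv; split.
- move=> u; rewrite /power_gauge_inv val_power_gauge exprK ?mulr_ge0 ?half_ge0
    ?(ltW C0)//.
  by rewrite mulrAC mulfV// mul1r to_halfK.
- move=> u; rewrite /power_gauge val_power_gauge_inv mulrCA mulfV// mulr1 rootnK
    ?half_ge0//.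
  exact: to_halfK.
- move=> u; rewrite /power_gauge.
  apply: (@continuous_comp _ R _ (fun v : @half_line R => (C * set_val v) ^+ k.+1)
    (@to_half R)).
    apply: (@continuous_comp _ R _ (fun v : @half_line R => C * set_val v : R)
      (fun t : R => t ^+ k.+1)).
      apply: (@continuous_comp _ _ _ (fun v : @half_line R => set_val v : R) ( *%R
        C)).
        exact: initial_continuous.
      exact: mulrl_continuous.
    exact: exprn_continuous.
  exact: continuous_to_half.
apply/continuous_ballP => u e e0; exists ((e * C) ^+ k.+1);
  first by rewrite exprn_gt0// mulr_gt0.
move=> v; rewrite !half_ballE !val_power_gauge_inv => h.
rewrite -mulrBl normrM normfV (gtr0_norm C0) ltr_pdivrMr//.
apply: (@lt_expr _ _ k); first by rewrite mulr_ge0 ?ltW.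
apply: le_lt_trans (dist_expr_le _ (rootn_ge0 _ _) (rootn_ge0 _ _)) _.
by rewrite !rootnK ?half_ge0.
Qed.

End power_gauge.

Section chain_space_dimension.
Context (X : metricType R) (C : R).
Hypotheses (C0 : 0 < C) (ud : uniformly_disconnected X C).

(** The new distance lies between [(mdist / C) ^+ p.+1] and [mdist ^+ p.+1], so
ratios are controlled by the gauge [u |-> (C * u) ^+ p.+1]. *)
Lemma snow_quasisymmetric p :
  quasisymmetric (fun x : X => x : chain_space p C0 ud).
Proof.
split.
  exists (fun x : chain_space p C0 ud => x : X); split => //.
    apply/continuous_ballP => x e e0; exists (Num.min 1 e);
      first by rewrite lt_min ltr01.
    move=> y; rewrite !ballEmdist/= lt_min => /andP[h1 h2].
    apply: le_lt_trans (snow_le _ _ _ _ _) _.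
    by rewrite exprS; apply: le_lt_trans h2;
      rewrite ler_piMr ?mdist_ge0 ?exprn_ile1 ?mdist_ge0// ltW.
  apply/continuous_ballP => x e e0; exists ((e / C) ^+ p.+1).
    by rewrite exprn_gt0// divr_gt0.
  move=> y; rewrite !ballEmdist/= => h; apply: (@lt_expr _ _ p); first exact: ltW.
  apply: le_lt_trans (snow_ge p C0 ud _ _) _.
  by rewrite mulrC -ltr_pdivlMr ?exprn_gt0// -expr_div_n.
exists (power_gauge C p); first exact: power_gauge_homeo.
move=> x a b xb; rewrite -set_valE val_power_gauge//.
have d0 : 0 < mdist x b by rewrite mdist_gt0; apply/eqP.
have d1 : 0 < mdist (x : chain_space p C0 ud) b by rewrite mdist_gt0; apply/eqP.
rewrite ler_pdivrMr// set_valE/= mulrA expr_div_n exprMn.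
rewrite mulrAC ler_pdivlMr ?exprn_gt0//.
apply: (@le_trans _ _ (mdist (x : chain_space p C0 ud) a *
   (C ^+ p.+1 * mdist (x : chain_space p C0 ud) b))).
  by rewrite ler_wpM2l ?mdist_ge0// snow_ge.
rewrite mulrA (mulrC (mdist _ _)) ler_wpM2r ?mdist_ge0//.
by rewrite ler_wpM2l ?exprn_ge0 ?(ltW C0)// snow_le.
Qed.

(** A ball of radius [r] of the new metric is, up to [C], a ball of radius
[r `^ (1 / p.+1)] of the old one. *)
Lemma snow_covering_exponent p alpha : 0 <= alpha -> covering_exponent X alpha ->
  covering_exponent (chain_space p C0 ud) (alpha / p.+1%:R).
Proof.
move=> a0 [C1 C10 H]; pose C' := Num.max 1 C.
have C'1 : 1 <= C' by rewrite le_max lexx.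
have C'0 : 0 < C' by apply: lt_le_trans C'1.
exists (C1 * C' `^ alpha) => [|r r' r0 rr' x]; first by rewrite mulr_gt0 ?powR_gt0.
have r'0 : 0 < r' := lt_le_trans r0 rr'.
have q0 : 0 < rootn p r by exact: powR_gt0.
have qq : rootn p r <= rootn p r'.
  by apply: ge0_ler_powR; rewrite ?nnegrE ?invr_ge0// ltW.
have [|s [sC sub]] := H (rootn p r) (C' * rootn p r') q0 _ x.
  by apply: le_trans qq _; rewrite ler_peMl ?rootn_ge0.
exists s; split.
  have E : C' * rootn p r' / rootn p r = C' * (r' / r) `^ (p.+1%:R)^-1.
    rewrite -mulrA /rootn powRM ?invr_ge0 ?(ltW r0) ?(ltW r'0)//;
      congr (_ * (_ * _)).
    by rewrite -!powR_inv1 ?powR_ge0 ?(ltW r0)// -!powRrM mulrC.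
  by rewrite E (powRM _ (ltW C'0) (powR_ge0 _ _)) -powRrM (mulrC _ alpha) mulrA in
    sC.
move=> y; rewrite ballEmdist/= => h.
have /sub[z zs] : ball (x : X) (C' * rootn p r') y.
  rewrite ballEmdist/=; apply: (@lt_expr _ _ p);
    first by rewrite mulr_ge0 ?rootn_ge0// ltW.
  apply: le_lt_trans (snow_ge p C0 ud _ _) _; rewrite exprMn rootnK ?(ltW r'0)//.
  apply: (@le_lt_trans _ _ (C' ^+ p.+1 * mdist (x : chain_space p C0 ud) y)).
    rewrite ler_wpM2r ?mdist_ge0//; apply: lerXn2r;
      rewrite ?nnegrE ?(ltW C0) ?(ltW C'0)//.
    by rewrite le_max lexx orbT.
  by rewrite ltr_pM2l ?exprn_gt0.
rewrite ballEmdist/= => zy; exists z => //; rewrite ballEmdist/=.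
apply: le_lt_trans (snow_le _ _ _ _ _) _; rewrite -[ltRHS](rootnK p (ltW r0)).
by rewrite ltr_pXn2r ?nnegrE ?mdist_ge0 ?rootn_ge0.
Qed.

Lemma assouad_dim_ge0 (Z : metricType R) : (0 <= assouad_dim Z)%E.
Proof. by apply: le_ereal_inf_tmp => _ [a [a0 _] <-]; rewrite lee_fin ltW. Qed.

Lemma conformal_assouad_dim_eq0 alpha : 0 < alpha -> covering_exponent X alpha ->
  conformal_assouad_dim X = 0%E.
Proof.
move=> a0 cov; apply/eqP; rewrite eq_le; apply/andP; split; last first.
  by apply: le_ereal_inf_tmp => _ [Y _ ->]; exact: assouad_dim_ge0.
apply/lee_addgt0Pr => e e0; rewrite add0e.
pose p := Num.truncn (alpha / e).
have pe : alpha / p.+1%:R <= e.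
  by rewrite ler_pdivrMr// mulrC -ler_pdivrMr// ltW// truncnS_gt.
apply: (@le_trans _ _ (assouad_dim (chain_space p C0 ud))).
  apply: ereal_inf_lbound; exists (chain_space p C0 ud) => //.
  by exists (fun x : X => x); exact: snow_quasisymmetric.
apply: (@le_trans _ _ (alpha / p.+1%:R)%:E); last by rewrite lee_fin.
apply: ereal_inf_lbound; exists (alpha / p.+1%:R) => //; split;
  first by rewrite divr_gt0.
by apply: covering_assouad_exponent; apply: snow_covering_exponent => //;
  exact: ltW.
Qed.

End chain_space_dimension.
End snowflake.

(** * Addresses of points of the carpet *)

Lemma scale_exists (R : realType) (b : nat) (e : R) : (1 < b)%N -> 0 < e -> e < 1 ->
  exists k, e * b%:R ^+ k < 1 /\ 1 <= e * b%:R ^+ k.+1.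
Proof.
move=> b1 e0 e1.
have ex : exists k, 1 <= e * b%:R ^+ k.
  exists (Num.truncn e^-1).+1; rewrite mulrC -ler_pdivrMr// div1r.
  apply: le_trans (ltW (truncnS_gt _)) _; rewrite -natrX ler_nat ltnW//.
  exact: ltn_expl.
case: (ex_minnP ex) => -[|k] hk kmin; first by move: hk;
  rewrite expr0 mulr1 leNgt e1.
exists k; split=> //; rewrite ltNge; apply/negP => /kmin; by rewrite ltnn.
Qed.

Section carpet_address.
Variables (R : realType) (n m : nat).
Hypotheses (hm : (1 < m)%N) (hn : (1 < n)%N).
Variable A : {set 'I_n * 'I_m}.
Local Notation S := (set_type (carpet R A)).

Lemma carpet_address_subproof (p : S) : exists a : nat -> 'I_n * 'I_m,
  (forall i, (1 <= i)%N -> a i \in A) /\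
  set_val p = (digit_series R n (fun i => (a i).1), digit_series R m (fun i => (a
    i).2)).
Proof. by have [a aA e] := set_valP p; exists a. Qed.

Definition address (p : S) : nat -> 'I_n * 'I_m := sval (cid
  (carpet_address_subproof p)).

Lemma address_in p i : (1 <= i)%N -> address p i \in A.
Proof. by rewrite /address; case: cid => a [aA _] /=; exact: aA. Qed.

Definition xaddr (p : S) i : nat := (address p i).1.
Definition yaddr (p : S) i : nat := (address p i).2.

Lemma val_address p :
  set_val p = (digit_series R n (xaddr p), digit_series R m (yaddr p)).
Proof. by rewrite /xaddr /yaddr /address; case: cid => a [aA e]; exact: e. Qed.

Lemma xaddr_lt p i : (xaddr p i < n)%N. Proof. exact: ltn_ord. Qed.
Lemma yaddr_lt p i : (yaddr p i < m)%N. Proof. exact: ltn_ord. Qed.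

Definition xindex k p := prefix_num n (xaddr p) k.
Definition yindex k p := prefix_num m (yaddr p) k.

Lemma xindexS k p : xindex k.+1 p = (xindex k p * n + xaddr p k.+1)%N.
Proof. by rewrite [(_ * n)%N]mulnC. Qed.

Lemma yindexS k p : yindex k.+1 p = (yindex k p * m + yaddr p k.+1)%N.
Proof. by rewrite [(_ * m)%N]mulnC. Qed.

Lemma mdist_planeE (p q : S) :
  mdist p q = Num.sqrt (((set_val p).1 - (set_val q).1) ^+ 2 +
                        ((set_val p).2 - (set_val q).2) ^+ 2).
Proof. by []. Qed.

Lemma mdist_ge_x (p q : S) : `|(set_val p).1 - (set_val q).1| <= mdist p q.
Proof.
by rewrite mdist_planeE -sqrtr_sqr ler_wsqrtr// lerDl sqr_ge0.
Qed.

Lemma mdist_ge_y (p q : S) : `|(set_val p).2 - (set_val q).2| <= mdist p q.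
Proof.
by rewrite mdist_planeE -sqrtr_sqr ler_wsqrtr// lerDr sqr_ge0.
Qed.

Lemma mdist_le_xy (p q : S) : mdist p q <=
  `|(set_val p).1 - (set_val q).1| + `|(set_val p).2 - (set_val q).2|.
Proof.
rewrite mdist_planeE; set a := _ - _; set b := _ - _.
rewrite -[leRHS]ger0_norm ?addr_ge0// -sqrtr_sqr ler_wsqrtr//.
have e x : x ^+ 2 = `|x| ^+ 2 :> R by rewrite real_normK// num_real.
rewrite (e a) (e b) sqrrD lerD2r lerDl mulrn_wge0// mulr_ge0//.
Qed.

Lemma xindex_near k p q :
  (xindex k p)%:R - (xindex k q)%:R <= n%:R ^+ k * mdist p q + 1.
Proof.
apply: le_trans (prefix_num_near R hn (xaddr_lt p) (xaddr_lt q) k) _.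
rewrite lerD2r ler_wpM2l ?exprn_ge0//.
by apply: le_trans (mdist_ge_x p q); rewrite !val_address.
Qed.

Lemma yindex_near k p q :
  (yindex k p)%:R - (yindex k q)%:R <= m%:R ^+ k * mdist p q + 1.
Proof.
apply: le_trans (prefix_num_near R hm (yaddr_lt p) (yaddr_lt q) k) _.
rewrite lerD2r ler_wpM2l ?exprn_ge0//.
by apply: le_trans (mdist_ge_y p q); rewrite !val_address.
Qed.

Lemma mdist_le_index k l p q : mdist p q <=
  (`|(xindex k p)%:R - (xindex k q)%:R| + 1) / n%:R ^+ k +
  (`|(yindex l p)%:R - (yindex l q)%:R| + 1) / m%:R ^+ l.
Proof.
have n0 : 0 < (n%:R : R) by rewrite ltr0n ltnW.
have m0 : 0 < (m%:R : R) by rewrite ltr0n ltnW.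
apply: le_trans (mdist_le_xy p q) _; rewrite !val_address /=.
apply: lerD; rewrite ler_pdivlMr ?exprn_gt0// mulrC.
  exact: digit_series_near (xaddr_lt p) (xaddr_lt q) k.
exact: digit_series_near (yaddr_lt p) (yaddr_lt q) l.
Qed.

End carpet_address.

(** * Carpets that are uniformly disconnected *)

Lemma barrier_exists (M c x : nat) : (c < M)%N -> (x %% M != c)%N ->
  exists H, [/\ (H %% M)%N = c, (H < x + M)%N & (x < H)%N].
Proof.
move=> cM xc; have M0 : (0 < M)%N by apply: leq_ltn_trans cM.
have xM := ltn_pmod x M0; have xE := divn_eq x M.
exists ((x %/ M + (c < x %% M)) * M + c)%N; split.
- by rewrite modnMDl modn_small.
- rewrite {3}xE; case: (ltnP c) => h /=; rewrite ?addn0 ?addn1 ?mulSn; lia.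
- rewrite {1}xE; move: xc; case: (ltngtP c (x %% M)) => h //= _;
    rewrite ?addn0 ?addn1 ?mulSn; lia.
Qed.

(** A walk with steps at most 1 that avoids a residue class stays between two
consecutive members of it. *)
Lemma barrier_step (M c H x y : nat) : (H %% M)%N = c -> (y %% M != c)%N ->
  (H < x + M)%N -> (x < H)%N -> (y <= x.+1)%N -> (x <= y.+1)%N ->
  (H < y + M)%N /\ (y < H)%N.
Proof.
move=> Hc yc h1 h2 h3 h4.
have ne1 : y != H by apply/eqP => E; rewrite E Hc eqxx in yc.
have ne2 : (y + M)%N != H by apply/eqP => E; rewrite -E modnDr in Hc;
  rewrite Hc eqxx in yc.
by split; lia.
Qed.

Section disconnected.
Variables (R : realType) (n m : nat).
Hypotheses (hm : (1 < m)%N) (hmn : (m < n)%N).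
Variable A : {set 'I_n * 'I_m}.
Local Notation S := (set_type (carpet R A)).
Let hn : (1 < n)%N := ltn_trans hm hmn.

Hypothesis row_gap : forall j : 'I_m, exists i : 'I_n, (i, j) \notin A.
Hypothesis empty_row : exists j0 : 'I_m, forall x, x \in A -> x.2 != j0.

(** Along the chain both integers move by at most 1 at each step.  The integer
of [y] avoids the residue of the empty row modulo [m], so it stays between two
barriers, and its first [B] digits form one of the integers [P.-1] and [P].
Choose [i1] missing in the row that [P.-1] has at position [a.+1], and [i2]
missing in the row that [P] has at position [a.+2].  The pair of digits
[i1 i2] at these positions is excluded in both cases, and the integer of [x]
avoids its residue modulo [n ^ 2]. *)
Lemma chain_index_near (a B : nat) (e : R) (p q : S) :
  (a.+2 <= B)%N -> e * n%:R ^+ a.+2 < 1 -> e * m%:R ^+ B.+1 < 1 -> chain e p q ->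
  [/\ (xindex a.+2 p <= xindex a.+2 q + n ^ 2)%N, (xindex a.+2 q <= xindex a.+2 p
    + n ^ 2)%N,
      (yindex B.+1 p <= yindex B.+1 q + m)%N & (yindex B.+1 q <= yindex B.+1 p +
        m)%N].
Proof.
move=> aB en em ch.
have [j0 j0P] := empty_row.
have m0 : (0 < m)%N := ltnW hm.
have ymod (u : S) : (yindex B.+1 u %% m != j0)%N.
  rewrite yindexS modnMDl modn_small ?yaddr_lt//.
  by have := j0P _ (address_in u (ltn0Sn B)).
have [H [Hm H1 H2]] := barrier_exists (ltn_ord j0) (ymod p).
pose P := (H %/ m)%N.
have HE : H = (P * m + j0)%N by rewrite -Hm; exact: divn_eq.
have [i1 i1P] := row_gap (Ordinal (ltn_pmod (P.-1 %/ m ^ (B - a.+1)) m0)).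
have [i2 i2P] := row_gap (Ordinal (ltn_pmod (P %/ m ^ (B - a.+2)) m0)).
have wn : (i1 * n + i2 < n ^ 2)%N.
  apply: (@leq_trans (i1.+1 * n)%N); first by rewrite mulSn addnC ltn_add2r.
  by rewrite expnS expn1 leq_mul2r ltn_ord orbT.
have yB (u : S) : (H < yindex B.+1 u + m)%N -> (yindex B.+1 u < H)%N ->
    yindex B u = P.-1 \/ yindex B u = P.
  rewrite yindexS; have := yaddr_lt u B.+1; have := ltn_ord j0.
  move: (yaddr u B.+1) (yindex B u) (nat_of_ord j0) HE => d y j -> jm dm h1 h2.
  have : (y < P.+1)%N by rewrite -(ltn_pmul2r m0) mulSn; lia.
  have : (P < y.+2)%N by rewrite -(ltn_pmul2r m0) !mulSn; lia.
  by move=> *; lia.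
have xmod (u : S) : (H < yindex B.+1 u + m)%N -> (yindex B.+1 u < H)%N ->
    (xindex a.+2 u %% n ^ 2 != i1 * n + i2)%N.
  move=> h1 h2; apply/eqP.
  have -> : xindex a.+2 u = (xindex a u * n ^ 2 + (xaddr u a.+1 * n + xaddr u
    a.+2))%N.
    by rewrite !xindexS expnS expn1; ring.
  have [x1 x2] := (xaddr_lt u a.+1, xaddr_lt u a.+2).
  have xx : (xaddr u a.+1 * n + xaddr u a.+2 < n ^ 2)%N.
    apply: (@leq_trans ((xaddr u a.+1).+1 * n)%N);
      first by rewrite mulSn addnC ltn_add2r.
    by rewrite expnS expn1 leq_mul2r x1 orbT.
  rewrite modnMDl modn_small// => E.
  have E2 : xaddr u a.+2 = i2.
    by have := congr1 (modn^~ n) E; rewrite !modnMDl !modn_small.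
  have E1 : xaddr u a.+1 = i1.
    have := congr1 (divn^~ n) E; rewrite !divnMDl ?(ltnW hn)// !divn_small ?addn0//.
  have dig i : (0 < i <= B)%N -> yaddr u i = ((yindex B u %/ m ^ (B - i)) %% m)%N.
    by move=> iB; rewrite [RHS](prefix_num_digit (yaddr_lt u) iB).
  have [yP|yP] := yB u h1 h2; [move: i1P|move: i2P]; apply/negP; rewrite negbK.
    have iB : (0 < a.+1 <= B)%N by apply/andP; split=> //; exact: ltnW.
    rewrite (_ : (i1, _) = address u a.+1) ?address_in// [RHS]surjective_pairing.
    by congr pair; apply: val_inj => //=; rewrite -yP [RHS](dig _ iB).
  rewrite (_ : (i2, _) = address u a.+2) ?address_in// [RHS]surjective_pairing.
  by congr pair; apply: val_inj => //=; rewrite -yP [RHS](dig a.+2 aB).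
have [G [Gm G1 G2]] := barrier_exists wn (xmod p H1 H2).
pose Q (u : S) := [/\ (H < yindex B.+1 u + m)%N, (yindex B.+1 u < H)%N,
  (G < xindex a.+2 u + n ^ 2)%N & (xindex a.+2 u < G)%N].
have : Q q.
  apply: (ch Q) => // u v [u1 u2 u3 u4] uv.
  have vu : mdist v u <= e by rewrite metric_sym.
  have near (x y : nat) (b k : nat) (u' v' : S) : x%:R - y%:R <= b%:R ^+ k * mdist
    u' v' + 1 ->
      mdist u' v' <= e -> e * b%:R ^+ k < 1 -> (x <= y.+1)%N.
    move=> h1 h2 h3; rewrite -ltnS -(ltr_nat R).
    have : b%:R ^+ k * mdist u' v' <= b%:R ^+ k * e by rewrite ler_wpM2l ?exprn_ge0.
    by rewrite -[y.+2%:R]natr1 -[y.+1%:R]natr1; lra.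
  have [v1 v2] := barrier_step Hm (ymod v) u1 u2
    (near _ _ _ _ _ _ (yindex_near hm B.+1 v u) vu em) (near _ _ _ _ _ _
      (yindex_near hm B.+1 u v) uv em).
  have [v3 v4] := barrier_step Gm (xmod v v1 v2) u3 u4
    (near _ _ _ _ _ _ (xindex_near hn a.+2 v u) vu en) (near _ _ _ _ _ _
      (xindex_near hn a.+2 u v) uv en).
  by split.
by case=> q1 q2 q3 q4; split; lia.
Qed.

(** Take [N] and [b] with [n ^ -N] and [m ^ -b] just above [e], and apply
[chain_index_near] one level higher for [x], which leaves room for the
condition [a.+2 <= B]; each extra level costs a factor [n]. *)
Lemma carpet_uniformly_disconnected : uniformly_disconnected S (4 * n%:R ^+ 5).
Proof.
move=> e p q e0 ch.
have nR : 1 < (n%:R : R) by rewrite ltr1n.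
have mR : 1 < (m%:R : R) by rewrite ltr1n.
have mnR : (m%:R : R) <= n%:R by rewrite ler_nat ltnW.
have n0 : 0 < (n%:R : R) by lra.
have m0 : 0 < (m%:R : R) by lra.
have pn k : 0 < (n%:R : R) ^+ k by rewrite exprn_gt0.
have pm k : 0 < (m%:R : R) ^+ k by rewrite exprn_gt0.
have small : 1 <= e * n%:R ^+ 3 -> mdist p q <= 4 * n%:R ^+ 5 * e.
  move=> h; apply: (@le_trans _ _ 2).
    apply: le_trans (mdist_le_index hm hn 0 0 p q) _.
    by rewrite /xindex /yindex /= subrr normr0 add0r expr0 divr1; lra.
  have : n%:R ^+ 3 * 1 <= (n%:R ^+ 5 : R).
    by rewrite (exprD _ 3 2) ler_pM2l// exprn_ege1// ltW.
  rewrite -(ler_pM2r e0); lra.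
(* For large [e] the diameter, at most 2, is already small enough. *)
case: (lerP 1 (e * n%:R ^+ 3)) => [//|h3].
have e1 : e < 1.
  apply: le_lt_trans h3; rewrite ler_peMr ?(ltW e0)// exprn_ege1// ltW//.
have [N [N1 N2]] := scale_exists hn e0 e1.
have [b [b1 b2]] := scale_exists hm e0 e1.
have mono (c k l : nat) : (1 < c)%N -> e * c%:R ^+ k < 1 -> 1 <= e * c%:R ^+ l.+1
  -> (k <= l)%N.
  move=> c1 hk hl; rewrite leqNgt; apply/negP => lk.
  have : e * c%:R ^+ l.+1 <= e * c%:R ^+ k by rewrite ler_pM2l// ler_weXn2l//
    ler1n ltnW.
  lra.
have N3 : (3 <= N)%N by apply: mono N2.
case: N N1 N2 N3 => [//|[//|[//|a]]] N1 N2 _.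
have Nb : (a.+3 <= b)%N.
  apply: (mono m) => //; apply: le_lt_trans N1; rewrite ler_pM2l//.
  by apply: lerXn2r => //; rewrite nnegrE ltW.
case: b b1 b2 Nb => [//|B] b1 b2 Nb.
have en : e * n%:R ^+ a.+2 < 1.
  by apply: le_lt_trans N1; rewrite ler_pM2l// ler_weXn2l// ltW.
have [x1 x2 y1 y2] := @chain_index_near a B e p q Nb en b1 ch.
apply: le_trans (mdist_le_index hm hn a.+2 B.+1 p q) _.
have dist (x y M : nat) : (x <= y + M)%N -> (y <= x + M)%N -> `|x%:R - y%:R| <=
  M%:R :> R.
  rewrite -!(ler_nat R) !natrD ler_norml => *; apply/andP; split; lra.
have X := dist _ _ _ x1 x2; have Y := dist _ _ _ y1 y2.
have N2' : (n%:R ^+ a.+2)^-1 <= e * n%:R ^+ 2 :> R.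
  by rewrite -div1r ler_pdivrMr// -mulrA -exprD.
have b2' : (m%:R ^+ B.+1)^-1 <= e * n%:R :> R.
  apply: (@le_trans _ _ (e * m%:R)); last by rewrite ler_pM2l.
  by rewrite -div1r ler_pdivrMr// -mulrA -exprS.
apply: (@le_trans _ _ ((n%:R ^+ 2 + 1) * (e * n%:R ^+ 2) + (n%:R + 1) * (e *
  n%:R))).
  apply: lerD; apply: ler_pM => //;
    rewrite ?invr_ge0 ?addr_ge0 ?(ltW (pn _)) ?(ltW (pm _))//.
    by rewrite lerD2r (le_trans X)// natrX.
  by rewrite lerD2r (le_trans Y).
have up k : (k <= 5)%N -> e * n%:R ^+ k <= e * n%:R ^+ 5.
  by move=> k5; rewrite ler_pM2l// ler_weXn2l// ltW.
have := up 4%N isT; have := up 2%N isT; have := up 1%N isT; rewrite expr1; lra.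
Qed.

End disconnected.

(** * Covering the carpet by approximate squares *)

Lemma cover_by_codes (R : realType) (X : metricType R) (K : finType) (B : set X)
    (x0 : X) (code : X -> K) (r : R) :
  (forall u v, B u -> B v -> code u = code v -> mdist u v < r) ->
  exists s : seq X, (size s <= #|K|)%N /\ B `<=` \bigcup_(y in [set` s]) ball y r.
Proof.
move=> H.
have /choice[f fP] : forall k : K, exists u, forall v, B v -> code v = k -> mdist
  u v < r.
  move=> k; have [[u [Bu ku]]|no] := pselect (exists u, B u /\ code u = k).
    by exists u => v Bv kv; apply: H => //; rewrite ku kv.
  by exists x0 => v Bv kv; exfalso; apply: no; exists v.
exists [seq f k | k <- enum K]; split; first by rewrite size_map cardE.
move=> v Bv; exists (f (code v)); last by rewrite ballEmdist/=; exact: fP.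
by rewrite /= map_f// mem_enum.
Qed.

Definition log_base (R : realType) (b x : nat) : R := ln x%:R / ln b%:R.

Lemma powR_log_base (R : realType) (b x : nat) : (1 < b)%N -> (0 < x)%N ->
  b%:R `^ log_base R b x = x%:R.
Proof.
move=> b1 x0; have b0 : (b%:R : R) != 0 by rewrite pnatr_eq0 -lt0n ltnW.
rewrite /powR (negbTE b0) divfK ?lnK ?posrE ?ltr0n//.
by rewrite gt_eqF// ln_gt0// ltr1n.
Qed.

Lemma log_base_ge0 (R : realType) (b x : nat) : (1 < b)%N -> (0 < x)%N ->
  0 <= log_base R b x.
Proof. by move=> b1 x0; rewrite divr_ge0// ln_ge0// ler1n// ltnW. Qed.

Lemma log_base_self (R : realType) (b : nat) : (1 < b)%N -> log_base R b b = 1.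
Proof. by move=> b1; rewrite /log_base divff// gt_eqF// ln_gt0// ltr1n. Qed.

Section cover_scale.
Variables (R : realType) (b : nat).
Hypothesis b1 : (1 < b)%N.

Lemma cover_scale_exists (r : R) : 0 < r -> exists k, 4 <= r * b%:R ^+ k.
Proof.
move=> r0; exists (Num.truncn (4 / r)).+1; rewrite mulrC -ler_pdivrMr//.
apply: le_trans (ltW (truncnS_gt _)) _; rewrite -natrX ler_nat ltnW//.
exact: ltn_expl.
Qed.

(** At the least level [k] with [4 <= r * b ^ k], intervals have length at most
[r / 4], so that two of them, one for each coordinate, fit into a ball of
radius [r]. *)
Lemma cover_scaleP (r : R) : 0 < r -> exists k,
  4 <= r * b%:R ^+ k /\ (forall l, 4 <= r * b%:R ^+ l -> (k <= l)%N).
Proof.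
by move=> /cover_scale_exists ex; case: (ex_minnP ex) => k h1 h2; exists k.
Qed.

Lemma cover_scale_ratio (r r' : R) k k' : 0 < r -> r <= r' ->
  4 <= r * b%:R ^+ k -> (forall l, 4 <= r * b%:R ^+ l -> (k <= l)%N) ->
  4 <= r' * b%:R ^+ k' -> (forall l, 4 <= r' * b%:R ^+ l -> (k' <= l)%N) ->
  (k' <= k)%N /\ b%:R ^+ (k - k') <= b%:R * (r' / r).
Proof.
move=> r0 rr' h1 h2 h3 h4; have bR : 1 < (b%:R : R) by rewrite ltr1n.
have bX j : 0 < (b%:R : R) ^+ j by rewrite exprn_gt0//; lra.
have kk : (k' <= k)%N.
  by apply: h4; apply: le_trans h1 _; rewrite ler_pM2r.
split=> //; rewrite mulrA ler_pdivlMr//.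
case: k h1 h2 kk => [|k] h1 h2 kk.
  by rewrite sub0n expr0 mul1r (le_trans rr')// ler_peMl; lra.
have hk : r * b%:R ^+ k < 4.
  by rewrite ltNge; apply/negP => /h2; rewrite ltnn.
rewrite -(ler_pM2r (bX k')) mulrAC -exprD subnK// exprS -!mulrA ler_pM2l;
  last by lra.
by rewrite mulrC; lra.
Qed.

Lemma cover_scale_index (r' : R) k' : 0 < r' ->
  4 <= r' * b%:R ^+ k' -> (forall l, 4 <= r' * b%:R ^+ l -> (k' <= l)%N) ->
  k' = 0%N \/ b%:R ^+ k' * r' <= (4 * b)%:R.
Proof.
move=> r0 h3 h4; case: k' h3 h4 => [|k] h1 h2; first by left.
right; have hk : r' * b%:R ^+ k < 4.
  by rewrite ltNge; apply/negP => /h2; rewrite ltnn.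
rewrite natrM mulrC exprS mulrCA mulrC ler_pM2r ?ltr0n ?(ltnW b1)//.
exact: ltW.
Qed.

Lemma expn_log_base_le (x d : nat) (rho : R) : (0 < x)%N -> 0 < rho ->
  b%:R ^+ d <= b%:R * rho -> (x ^ d)%:R <= x%:R * rho `^ log_base R b x.
Proof.
move=> x0 rho0 h; rewrite natrX -{1 2}(powR_log_base R b1 x0).
rewrite -powR_mulrn ?powR_ge0// -powRrM mulrC powRrM powR_mulrn//.
rewrite -powRM ?(ltW rho0)//.
by apply: ge0_ler_powR; rewrite ?nnegrE ?log_base_ge0 ?exprn_ge0 ?mulr_ge0 ?(ltW
  rho0).
Qed.

End cover_scale.

Section carpet_covering.
Variables (R : realType) (n m : nat).
Hypotheses (hm : (1 < m)%N) (hmn : (m < n)%N).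
Variable A : {set 'I_n * 'I_m}.
Local Notation S := (set_type (carpet R A)).
Let hn : (1 < n)%N := ltn_trans hm hmn.

Variables (s t : nat) (frow : 'I_m -> 'I_s.+1) (fcol : 'I_n * 'I_m -> 'I_t.+1).
Hypothesis frow_inj : {in A &, forall x y, frow x.2 = frow y.2 -> x.2 = y.2}.
Hypothesis fcol_inj : {in A &, forall x y, x.2 = y.2 -> fcol x = fcol y -> x = y}.

(** The rows are decoded first; since [a' <= b'], they are known wherever a
digit of [x] has to be decoded from its rank in its row. *)
Lemma square_code_inj (a a' b b' : nat) (u v : S) :
  (a <= a')%N -> (b <= b')%N -> (a' <= b')%N ->
  xindex a u = xindex a v -> yindex b u = yindex b v ->
  (forall i, (b < i <= b')%N -> frow (address u i).2 = frow (address v i).2) ->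
  (forall i, (a < i <= a')%N -> fcol (address u i) = fcol (address v i)) ->
  xindex a' u = xindex a' v /\ yindex b' u = yindex b' v.
Proof.
move=> aa bb ab Ex Ey hrow hcol.
have Y : yindex b' u = yindex b' v.
  apply: eq_prefix_num bb Ey _ => i ib; congr nat_of_ord.
  by apply: frow_inj; rewrite ?address_in ?hrow//; case: i ib => [|i].
split=> //; apply: eq_prefix_num aa Ex _ => i /andP[ia ia'].
have i0 : (0 < i)%N by apply: leq_ltn_trans ia.
suff -> : xaddr u i = xaddr v i by [].
rewrite /xaddr; congr (nat_of_ord _.1); apply: fcol_inj; rewrite ?address_in//.
  apply: val_inj; have iB : (0 < i <= b')%N by rewrite i0 (leq_trans ia').
  have e := prefix_num_digit (yaddr_lt u) iB;
    have e' := prefix_num_digit (yaddr_lt v) iB.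
  by have := Y; rewrite /yindex => Y'; rewrite Y' e' in e.
by apply: hcol; rewrite ia.
Qed.

(** A ball of radius [r] meets boundedly many approximate squares of its own
scale. *)
Lemma index_window (k : nat) (b : nat) (r : R) (X X' : nat) (dist : R) :
  k = 0%N \/ b%:R ^+ k * r <= (4 * b)%:R -> dist < r ->
  (k = 0%N -> X = X') -> X%:R - X'%:R <= b%:R ^+ k * dist + 1 ->
  (X <= X' + (4 * b).+1)%N.
Proof.
move=> [k0|h] dr X0 h1; first by rewrite X0// leq_addr.
rewrite -(ler_nat R) natrD -natr1.
have : b%:R ^+ k * dist <= b%:R ^+ k * r by rewrite ler_wpM2l ?exprn_ge0// ltW.
lra.
Qed.

Lemma ltn_sub_window (i b b' : nat) : (b' < i)%N -> (i <= b)%N -> (i - b'.+1 < b -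
  b')%N.
Proof. lia. Qed.

Lemma window_code_inj (H x u v : nat) : (u <= x + H)%N -> (x <= u + H)%N ->
  (v <= x + H)%N -> (x <= v + H)%N ->
  inord (u + H - x) = inord (v + H - x) :> 'I_(2 * H).+1 -> u = v.
Proof.
move=> u1 u2 v1 v2 /(congr1 val); rewrite /= !inordK; lia.
Qed.

(** Points of a ball of radius [r'] are coded by their approximate square of
scale [r'], which has boundedly many values, by the [b - b'] further rows and
by the ranks of the [a - a'] further digits of [x] in their rows; equal codes
force a distance less than [r]. *)
Lemma carpet_covering_exponent :
  covering_exponent S (log_base R m s.+1 + log_base R n t.+1).
Proof.
(* Both indices of a point of the ball differ by at most [Hn], [Hm] from those
   of its centre; the shift keeps the truncated subtraction in the code exact. *)
pose Hn := (4 * n).+1; pose Hm := (4 * m).+1.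
pose C0 := ((2 * Hn).+1 * (2 * Hm).+1)%N.
exists ((C0 * s.+1 * t.+1)%N%:R) => [|r r' r0 rr' x]; first by rewrite ltr0n.
have r'0 : 0 < r' := lt_le_trans r0 rr'.
have [a [a1 a2]] := cover_scaleP hn r0; have [a' [a'1 a'2]] := cover_scaleP hn r'0.
have [b [b1 b2]] := cover_scaleP hm r0; have [b' [b'1 b'2]] := cover_scaleP hm r'0.
have [aa adr] := cover_scale_ratio hn r0 rr' a1 a2 a'1 a'2.
have [bb bdr] := cover_scale_ratio hm r0 rr' b1 b2 b'1 b'2.
have wn := cover_scale_index hn r'0 a'1 a'2.
have wm := cover_scale_index hm r'0 b'1 b'2.
have ab : (a <= b)%N.
  apply: a2; apply: le_trans b1 _; rewrite ler_pM2l//.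
  by apply: lerXn2r; rewrite ?nnegrE// ler_nat ltnW.
pose code (u : S) : 'I_(2 * Hn).+1 * 'I_(2 * Hm).+1 *
     {ffun 'I_(b - b') -> 'I_s.+1} * {ffun 'I_(a - a') -> 'I_t.+1} :=
  (inord (xindex a' u + Hn - xindex a' x), inord (yindex b' u + Hm - yindex b' x),
   [ffun i : 'I_(b - b') => frow (address u (b' + i).+1).2],
   [ffun i : 'I_(a - a') => fcol (address u (a' + i).+1)]).
have [|S1 [S1c sub]] := @cover_by_codes R S _ (ball x r') x code r.
  move=> u v; rewrite !ballEmdist/= => xu xv [cx cy /ffunP crow /ffunP ccol].
  have win (w : S) : mdist x w < r' ->
    [/\ (xindex a' w <= xindex a' x + Hn)%N, (xindex a' x <= xindex a' w + Hn)%N,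
        (yindex b' w <= yindex b' x + Hm)%N & (yindex b' x <= yindex b' w + Hm)%N].
    move=> xw; have wx : mdist w x < r' by rewrite metric_sym.
    split.
    - by apply: (index_window wn wx) (xindex_near hn a' w x) => ->.
    - by apply: (index_window wn xw) (xindex_near hn a' x w) => ->.
    - by apply: (index_window wm wx) (yindex_near hm b' w x) => ->.
    - by apply: (index_window wm xw) (yindex_near hm b' x w) => ->.
  have [u1 u2 u3 u4] := win u xu; have [v1 v2 v3 v4] := win v xv.
  have Ex := window_code_inj u1 u2 v1 v2 cx.
  have Ey := window_code_inj u3 u4 v3 v4 cy.
  have [Ex' Ey'] : xindex a u = xindex a v /\ yindex b u = yindex b v.
    apply: (square_code_inj aa bb ab Ex Ey) => i /andP[i1 i2].
      have ib := ltn_sub_window i1 i2.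
      by have := crow (Ordinal ib); rewrite !ffunE /= -addSn subnKC.
    have ia := ltn_sub_window i1 i2.
    by have := ccol (Ordinal ia); rewrite !ffunE /= -addSn subnKC.
  apply: le_lt_trans (mdist_le_index hm hn a b u v) _.
  rewrite Ex' Ey' !subrr normr0 add0r !div1r.
  have i1 : (n%:R ^+ a)^-1 <= r / 4.
    by rewrite -div1r ler_pdivrMr ?exprn_gt0 ?ltr0n ?(ltnW hn)//; lra.
  have i2 : (m%:R ^+ b)^-1 <= r / 4.
    by rewrite -div1r ler_pdivrMr ?exprn_gt0 ?ltr0n ?(ltnW hm)//; lra.
  by lra.
exists S1; split=> //.
have rho0 : 0 < r' / r by rewrite divr_gt0.
apply: (@le_trans _ _ (C0 * (s.+1 ^ (b - b') * t.+1 ^ (a - a')))%N%:R).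
  rewrite ler_nat; apply: leq_trans S1c _.
  by rewrite !card_prod !card_ffun !card_ord mulnA.
rewrite -mulnA !natrM -!mulrA ler_wpM2l//.
rewrite powRD; last by rewrite (gt_eqF rho0) implybT.
have e1 := expn_log_base_le hm (ltn0Sn s) rho0 bdr.
have e2 := expn_log_base_le hn (ltn0Sn t) rho0 adr.
rewrite ler_wpM2l// [leRHS](_ : _ = s.+1%:R * (r' / r) `^ log_base R m s.+1 *
  (t.+1%:R * (r' / r) `^ log_base R n t.+1)); last by ring.
exact: ler_pM.
Qed.

End carpet_covering.

(** * Points with prescribed digits *)

Lemma prefix_num_cat b x a l :
  prefix_num b x (a + l) = 
    (prefix_num b x a * b ^ l + prefix_num b (fun i => x (a + i)%N) l)%N.
Proof.
elim: l => [|l IH]; first by rewrite addn0 expn0 muln1 addn0.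
by rewrite addnS /= IH expnS -addnS; ring.
Qed.

Lemma nat_digit_neq b k i j : (i < b ^ k)%N -> (j < b ^ k)%N -> i <> j ->
  exists2 r, (0 < r <= k)%N & nat_digit b k i r <> nat_digit b k j r.
Proof.
move=> ik jk ij; have [//|no] := pselect (exists2 r, (0 < r <= k)%N & nat_digit b
  k i r <> nat_digit b k j r).
exfalso; apply: ij; rewrite -(prefix_nat_digit_full ik) -(prefix_nat_digit_full jk).
apply: (@eq_prefix_num _ _ _ 0) => // r rk; apply: contrapT => h; apply: no;
  by exists r.
Qed.

Lemma digit_series_sep (R : realType) (b K : nat) (x x' : nat -> nat) : (1 < b)%N ->
  (forall i, (x i < b)%N) -> (forall i, (x' i < b)%N) ->
  (forall i, (K < i)%N -> x i = x' i) ->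
  (exists2 i, (0 < i <= K)%N & x i <> x' i) ->
  1 <= b%:R ^+ K * `|digit_series R b x - digit_series R b x'|.
Proof.
move=> b1 xb xb' tl [i iK ne].
rewrite -[b%:R ^+ K]ger0_norm ?exprn_ge0// -normrM digit_seriesB//.
have : prefix_num b x K != prefix_num b x' K.
  by apply/eqP => E; apply: ne;
    rewrite -(prefix_num_digit xb iK) -(prefix_num_digit xb' iK) E.
rewrite neq_ltn => /orP[]; rewrite -(ler_nat R) -natr1 => h.
  by rewrite distrC; have := ler_norm ((prefix_num b x' K)%:R - (prefix_num b x
    K)%:R : R); lra.
by have := ler_norm ((prefix_num b x K)%:R - (prefix_num b x' K)%:R : R); lra.
Qed.

Lemma digit_series_same_prefix (R : realType) (b K : nat) (x x' : nat -> nat) : (1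
  < b)%N ->
  (forall i, (x i < b)%N) -> (forall i, (x' i < b)%N) ->
  (forall i, (0 < i <= K)%N -> x i = x' i) ->
  b%:R ^+ K * `|digit_series R b x - digit_series R b x'| <= 1.
Proof.
move=> b1 xb xb' E; apply: le_trans (digit_series_near R b1 xb xb' K) _.
by rewrite (@eq_prefix_num b x x' 0 K)// subrr normr0 add0r.
Qed.

Section words.
Variables (R : realType) (n m : nat).
Hypotheses (hm : (1 < m)%N) (hn : (1 < n)%N).
Variable A : {set 'I_n * 'I_m}.
Variables (s t : nat) (j : 'I_m).
Hypotheses (s0 : (0 < s)%N) (t0 : (0 < t)%N).
Variables (colpt rowpt : nat -> 'I_n * 'I_m).
Hypothesis colptA : forall d, (d < t)%N -> colpt d \in A /\ (colpt d).2 = j.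
Hypothesis colpt_inj : forall d d', (d < t)%N -> (d' < t)%N ->
  (colpt d).1 = (colpt d').1 -> d = d'.
Hypothesis rowptA : forall d, (d < s)%N -> rowpt d \in A.
Hypothesis rowpt_inj : forall d d', (d < s)%N -> (d' < s)%N ->
  (rowpt d).2 = (rowpt d').2 -> d = d'.
Variables (a l b k : nat).
Hypothesis alb : (a + l <= b)%N.

(** Up to position [b] all digits lie in the row [j], and the integer [c] is
written in the positions from [a + 1] to [a + l]; after that the integer [e] is
written in the rows at the positions from [b + 1] to [b + k].  With [n ^ a]
close to [m ^ b], the free digits of [x] and of [y] describe the same scale,
and the position of [c] hardly interacts with that of [e]. *)
Definition word (c e i : nat) : 'I_n * 'I_m :=
  if (i <= b)%N then colpt (if (a < i <= a + l)%N then nat_digit t l c (i - a)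
    else 0%N)
  else rowpt (if (i <= b + k)%N then nat_digit s k e (i - b) else 0%N).

Lemma nat_digit_lt B K i r : (0 < B)%N -> (nat_digit B K i r < B)%N.
Proof. exact: ltn_pmod. Qed.

Lemma word_in c e i : word c e i \in A.
Proof.
rewrite /word; case: ifP => _.
  by apply: (colptA _).1; case: ifP => _ //; exact: nat_digit_lt.
by apply: rowptA; case: ifP => _ //; exact: nat_digit_lt.
Qed.

Lemma word_row c e i : (i <= b)%N -> (word c e i).2 = j.
Proof.
move=> ib; rewrite /word ib; apply: (colptA _).2.
by case: ifP => _ //; exact: nat_digit_lt.
Qed.

Lemma word_col c e r : (0 < r <= l)%N -> word c e (a + r) = colpt (nat_digit t l c
  r).
Proof.
move=> /andP[r0 rl]; rewrite /word (leq_trans _ alb) ?leq_add2l// rl.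
by rewrite -[X in (X < _)%N]addn0 ltn_add2l r0/= addKn.
Qed.

Lemma word_tail c e r : (0 < r <= k)%N -> word c e (b + r) = rowpt (nat_digit s k
  e r).
Proof.
move=> /andP[r0 rk]; rewrite /word leq_add2l rk addKn.
by rewrite -[X in (_ <= X)%N]addn0 leq_add2l leqNgt r0.
Qed.

Definition xword c e i : nat := (word c e i).1.
Definition yword c e i : nat := (word c e i).2.
Definition xval c e : R := digit_series R n (xword c e).
Definition yval c e : R := digit_series R m (yword c e).

Lemma xword_lt c e i : (xword c e i < n)%N. Proof. exact: ltn_ord. Qed.
Lemma yword_lt c e i : (yword c e i < m)%N. Proof. exact: ltn_ord. Qed.

Lemma xword_same c c' e i : (a + l < i)%N -> xword c e i = xword c' e i.
Proof.
by move=> h; rewrite /xword /word; case: ifP => // _;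
  rewrite [(i <= a + l)%N]leqNgt h andbF.
Qed.

Lemma yword_same c c' e e' i : (b + k < i)%N -> yword c e i = yword c' e' i.
Proof.
move=> h; rewrite /yword /word ifN; last by lia.
by rewrite ifN; [rewrite ifN; [rewrite ifN; [by []|lia]|lia]|lia].
Qed.

Lemma yval_same c c' e : yval c e = yval c' e.
Proof.
congr digit_series; apply/funext => i; rewrite /yword.
case: (leqP i b) => h; first by rewrite !word_row.
by rewrite /word [(i <= b)%N]leqNgt h.
Qed.

Lemma yval_sep c c' e e' : (e < s ^ k)%N -> (e' < s ^ k)%N -> e <> e' ->
  1 <= m%:R ^+ (b + k) * `|yval c e - yval c' e'|.
Proof.
move=> ek ek' ne; apply: digit_series_sep => //; first exact: yword_lt.
- exact: yword_lt.
- by move=> i; exact: yword_same.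
have [r rk h] := nat_digit_neq ek ek' ne.
exists (b + r)%N; first by lia.
rewrite /yword !word_tail// => /val_inj /rowpt_inj E; apply: h.
by apply: E; exact: nat_digit_lt.
Qed.

Lemma xval_sep c c' e : (c < t ^ l)%N -> (c' < t ^ l)%N -> c <> c' ->
  1 <= n%:R ^+ (a + l) * `|xval c e - xval c' e|.
Proof.
move=> ck ck' ne; apply: digit_series_sep => //; first exact: xword_lt.
- exact: xword_lt.
- by move=> i; exact: xword_same.
have [r rk h] := nat_digit_neq ck ck' ne.
exists (a + r)%N; first by lia.
rewrite /xword !word_col// => /val_inj /colpt_inj E; apply: h.
by apply: E; exact: nat_digit_lt.
Qed.

Lemma xval_near c c' e e' : n%:R ^+ a * `|xval c e - xval c' e'| <= 1.
Proof.
apply: digit_series_same_prefix => // [i|i|i /andP[_ ia]]; [exact: xword_lt..|].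
have ib : (i <= b)%N by lia.
by rewrite /xword /word ib ltnNge ia.
Qed.

Lemma yval_near c c' e e' : m%:R ^+ b * `|yval c e - yval c' e'| <= 1.
Proof.
apply: digit_series_same_prefix => // [i|i|i /andP[_ ib]]; [exact: yword_lt..|].
by rewrite /yword !word_row.
Qed.

Lemma xval_tail_near c e e' : n%:R ^+ b * `|xval c e - xval c e'| <= 1.
Proof.
apply: digit_series_same_prefix => // [i|i|i /andP[_ ib]]; [exact: xword_lt..|].
by rewrite /xword /word ib.
Qed.

Lemma xval_full c c' e : t = n -> (forall d, (d < n)%N -> (colpt d).1 = d :> nat) ->
  (c < n ^ l)%N -> (c' < n ^ l)%N ->
  n%:R ^+ (a + l) * (xval c e - xval c' e) = c%:R - c'%:R.
Proof.
move=> tn full cl cl'; rewrite /xval digit_seriesB//;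
  [|exact: xword_lt..|by move=> i; exact: xword_same].
rewrite !prefix_num_cat.
have -> : prefix_num n (xword c e) a = prefix_num n (xword c' e) a.
  apply: (@eq_prefix_num _ _ _ 0) => // i /andP[_ ia].
  have ib : (i <= b)%N by lia.
  by rewrite /xword /word ib ltnNge ia.
have dig c1 : (c1 < n ^ l)%N -> prefix_num n (fun i => xword c1 e (a + i)) l = c1.
  move=> c1l; rewrite -[RHS](prefix_nat_digit_full c1l).
  apply: (@eq_prefix_num _ _ _ 0) => // i il.
  by rewrite /xword word_col// tn full// nat_digit_lt// ltnW.
by rewrite !dig// !natrD; ring.
Qed.

Lemma yval_full c c' e e' : s = m -> (forall d, (d < m)%N -> (rowpt d).2 = d :>
  nat) ->
  (e < m ^ k)%N -> (e' < m ^ k)%N ->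
  m%:R ^+ (b + k) * (yval c e - yval c' e') = e%:R - e'%:R.
Proof.
move=> sm full el el'; rewrite /yval digit_seriesB//;
  [|exact: yword_lt..|by move=> i; exact: yword_same].
rewrite !prefix_num_cat.
have -> : prefix_num m (yword c e) b = prefix_num m (yword c' e') b.
  apply: (@eq_prefix_num _ _ _ 0) => // i /andP[_ ib].
  by rewrite /yword !word_row.
have dig c1 e1 : (e1 < m ^ k)%N -> prefix_num m (fun i => yword c1 e1 (b + i)) k =
  e1.
  move=> e1l; rewrite -[RHS](prefix_nat_digit_full e1l).
  apply: (@eq_prefix_num _ _ _ 0) => // i il.
  by rewrite /yword word_tail// sm full// nat_digit_lt// ltnW.
by rewrite !dig// !natrD; ring.
Qed.

Lemma word_point_exists : exists pt : nat -> nat -> set_type (carpet R A),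
  forall c e, set_val (pt c e) = (xval c e, yval c e).
Proof.
have /choice[pt Hpt] : forall ce : nat * nat, exists p : set_type (carpet R A),
    set_val p = (xval ce.1 ce.2, yval ce.1 ce.2).
  move=> [c e] /=; have h : carpet R A (xval c e, yval c e).
    by exists (word c e) => // i _; exact: word_in.
  by exists (SigSub (mem_set h)).
by exists (fun c e => pt (c, e)) => c e; exact: Hpt.
Qed.

Let n0 : 0 < n%:R :> R. Proof. by rewrite ltr0n ltnW. Qed.
Let m0 : 0 < m%:R :> R. Proof. by rewrite ltr0n ltnW. Qed.

(** The points of these words form an approximate product: [c] moves [x]
alone, and [e] moves [y] up to an error [n ^ -b] in [x].  If all digits
are available in the row, respectively if all rows are, the corresponding
coordinate runs through an arithmetic progression. *)
Lemma word_points_exist : exists pt : nat -> nat -> set_type (carpet R A),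
  [/\ forall c c' e, (c < t ^ l)%N -> (c' < t ^ l)%N -> c <> c' ->
        1 <= n%:R ^+ (a + l) * mdist (pt c e) (pt c' e),
      forall c c' e e', (e < s ^ k)%N -> (e' < s ^ k)%N -> e <> e' ->
        1 <= m%:R ^+ (b + k) * mdist (pt c e) (pt c' e'),
      forall c c' e e', mdist (pt c e) (pt c' e') <= (n%:R ^+ a)^-1 + (m%:R ^+
        b)^-1,
      t = n -> (forall d, (d < n)%N -> (colpt d).1 = d :> nat) ->
        forall c c' e, (c < n ^ l)%N -> (c' < n ^ l)%N ->
        n%:R ^+ (a + l) * mdist (pt c e) (pt c' e) = `|c%:R - c'%:R|
    & s = m -> (forall d, (d < m)%N -> (rowpt d).2 = d :> nat) ->
        forall c e e', (e < m ^ k)%N -> (e' < m ^ k)%N ->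
        `|e%:R - e'%:R| <= m%:R ^+ (b + k) * mdist (pt c e) (pt c e') <=
        `|e%:R - e'%:R| + m%:R ^+ (b + k) / n%:R ^+ b].
Proof.
have [pt ptE] := word_point_exists; exists pt.
have nX i : 0 < n%:R ^+ i :> R by rewrite exprn_gt0.
have mX i : 0 < m%:R ^+ i :> R by rewrite exprn_gt0.
have dx c e c' e' : `|xval c e - xval c' e'| <= mdist (pt c e) (pt c' e').
  by have := mdist_ge_x (pt c e) (pt c' e'); rewrite !ptE.
have dy c e c' e' : `|yval c e - yval c' e'| <= mdist (pt c e) (pt c' e').
  by have := mdist_ge_y (pt c e) (pt c' e'); rewrite !ptE.
have dxy c e c' e' : mdist (pt c e) (pt c' e') <=
    `|xval c e - xval c' e'| + `|yval c e - yval c' e'|.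
  by have := mdist_le_xy (pt c e) (pt c' e'); rewrite !ptE.
split.
- move=> c c' e ct ct' ne; apply: le_trans (xval_sep e ct ct' ne) _.
  by rewrite ler_pM2l.
- move=> c c' e e' es es' ne; apply: le_trans (yval_sep c c' es es' ne) _.
  by rewrite ler_pM2l.
- move=> c c' e e'; apply: le_trans (dxy _ _ _ _) (lerD _ _).
    by rewrite -div1r ler_pdivlMr// mulrC xval_near.
  by rewrite -div1r ler_pdivlMr// mulrC yval_near.
- move=> tn full c c' e cn cn'; rewrite -(xval_full e tn full cn cn').
  rewrite normrM (ger0_norm (ltW (nX _))); congr (_ * _); apply/eqP.
  rewrite eq_le dx andbT; apply: le_trans (dxy _ _ _ _) _.
  by rewrite (yval_same c c') subrr normr0 addr0.
- move=> sm full c e e' em em'; rewrite -(yval_full c c sm full em em').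
  rewrite normrM (ger0_norm (ltW (mX _))) ler_pM2l// dy/= -mulrDr ler_pM2l//.
  apply: le_trans (dxy _ _ _ _) _; rewrite addrC lerD2l.
  by rewrite -div1r ler_pdivlMr// mulrC xval_tail_near.
Qed.

End words.

(** * Grids in the carpet *)

Lemma expn_succ_bernoulli m a : (m ^ a * (m + a) <= m * m.+1 ^ a)%N.
Proof.
elim: a => [|a IH]; first by rewrite !expn0 mul1n muln1 addn0.
rewrite !expnS; apply: (@leq_trans (m.+1 * (m ^ a * (m + a)))%N); last first.
  by rewrite [leqRHS]mulnCA leq_mul2l IH orbT.
by move: (m ^ a)%N => x; nia.
Qed.

(** By the Bernoulli inequality [(1 + 1 / m) ^ a >= 1 + a / m], which exceeds
[m ^ K] for the given [a]. *)
Lemma leq_expn_shift m n K a : (0 < m)%N -> (m < n)%N -> (m * m ^ K <= a)%N ->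
  (m ^ (a + K) <= n ^ a)%N.
Proof.
move=> m0 mn aK; rewrite -(leq_pmul2l m0).
apply: (@leq_trans (m * m.+1 ^ a)%N);
  last by rewrite leq_pmul2l// leq_exp2r// (leq_trans _ aK)// muln_gt0 m0 expn_gt0
    m0.
apply: leq_trans (expn_succ_bernoulli m a).
by rewrite expnD mulnCA leq_mul2l (leq_trans aK) ?orbT// leq_addl.
Qed.

(** Since [m < n], the level [b] of [y] gets as far ahead of the level [a] of
[x] as desired when [a] grows. *)
Lemma grid_parameters n m K : (1 < m)%N -> (m < n)%N -> exists a b,
  [/\ (a + K <= b)%N, (n ^ a <= m ^ b)%N, (m ^ b <= m * n ^ a)%N & (m ^ (b + K) <=
    n ^ b)%N].
Proof.
move=> m1 mn; pose a := (m * m ^ K)%N.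
have m0 : (0 < m)%N by apply: ltnW.
have na : (0 < n ^ a)%N by rewrite expn_gt0 (ltn_trans m0 mn).
have /andP[h1 h2] := trunc_log_bounds m1 na.
exists a, (trunc_log m (n ^ a)).+1.
have aK : (a + K <= (trunc_log m (n ^ a)).+1)%N.
  rewrite -(leq_exp2l _ _ m1); apply: leq_trans (ltnW h2).
  exact: leq_expn_shift.
split=> //; [exact: ltnW|by rewrite expnS leq_mul2l h1 orbT|].
by apply: leq_expn_shift => //; apply: leq_trans aK; rewrite leq_addr.
Qed.

(** [b `^ log_base b s = s], and passing from [b ^ k] to [b ^ k.+1] costs a
factor [s]. *)
Lemma card_power_bound (R : realType) (b s k N : nat) : (1 < b)%N -> (0 < s)%N ->
  (N <= b ^ k.+1)%N -> s%:R^-1 * N%:R `^ log_base R b s <= (s ^ k)%:R.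
Proof.
move=> b1 s0 Nb; have sR : 0 < (s%:R : R) by rewrite ltr0n.
rewrite mulrC ler_pdivrMr// -natrM -expnSr.
apply: (@le_trans _ _ ((b ^ k.+1)%:R `^ log_base R b s)).
  by apply: ge0_ler_powR; rewrite ?log_base_ge0 ?nnegrE// ler_nat.
rewrite natrX -powR_mulrn// -powRrM mulrC powRrM powR_log_base// powR_mulrn//.
by rewrite natrX.
Qed.

Section grids.
Variables (R : realType) (n m : nat).
Hypotheses (hm : (1 < m)%N) (hmn : (m < n)%N).
Variable A : {set 'I_n * 'I_m}.
Let hn : (1 < n)%N := ltn_trans hm hmn.
Local Notation S := (set_type (carpet R A)).
Variables (s t : nat) (j : 'I_m).
Hypotheses (s0 : (0 < s)%N) (t0 : (0 < t)%N).
Variables (colpt rowpt : nat -> 'I_n * 'I_m).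
Hypothesis colptA : forall d, (d < t)%N -> colpt d \in A /\ (colpt d).2 = j.
Hypothesis colpt_inj : forall d d', (d < t)%N -> (d' < t)%N ->
  (colpt d).1 = (colpt d').1 -> d = d'.
Hypothesis rowptA : forall d, (d < s)%N -> rowpt d \in A.
Hypothesis rowpt_inj : forall d d', (d < s)%N -> (d' < s)%N ->
  (rowpt d).2 = (rowpt d').2 -> d = d'.

Let nX k : 0 < (n%:R : R) ^+ k. Proof. by rewrite exprn_gt0// ltr0n ltnW. Qed.
Let mX k : 0 < (m%:R : R) ^+ k. Proof. by rewrite exprn_gt0// ltr0n ltnW. Qed.
Let m1 : 1 < m%:R :> R. Proof. by rewrite ltr1n. Qed.

(** The segments are horizontal: [x] runs through [n ^ l] equally spaced
values, and the fibres are the [s ^ k] words of rows, where [m ^ k] is as close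
to [n ^ l] as possible. *)
Lemma grids_full_row : t = n -> (forall d, (d < n)%N -> (colpt d).1 = d :> nat) ->
  has_grids S (2 * m%:R + 2) s%:R^-1 (log_base R m s).
Proof.
move=> tn full N0; have m1R : 1 < m%:R :> R := m1; pose l := N0.+1;
  pose k := trunc_log m (n ^ l).
have nl0 : (0 < n ^ l)%N by rewrite expn_gt0 (ltnW hn).
have /andP[k1 k2] := trunc_log_bounds hm nl0; rewrite -/k in k1 k2.
have [a [b [abK h1 h2 _]]] := grid_parameters (k + l) hm hmn.
have alb : (a + l <= b)%N by rewrite (leq_trans _ abK)// leq_add2l leq_addl.
have [pt [xsep ysep near xfull _]] :=
  word_points_exist R hm hn s0 t0 colptA colpt_inj rowptA rowpt_inj k alb.
have {}xfull := xfull tn full; rewrite tn in xsep.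
pose N := (n ^ l).-1.
have NE : (N.+1 = n ^ l)%N by rewrite prednK.
have NR : N%:R + 1 = n%:R ^+ l :> R by rewrite natr1 NE natrX.
have Nl2 : 2 <= n%:R ^+ l :> R.
  by rewrite -natrX ler_nat (leq_trans hn)// -[n in leqLHS]expn1 leq_exp2l.
have lam0 : 0 < (n%:R ^+ (a + l))^-1 :> R by rewrite invr_gt0.
have r1 : n%:R ^+ a <= m%:R ^+ b :> R by rewrite -!natrX ler_nat.
have r2 : m%:R ^+ b <= m%:R * n%:R ^+ a :> R by rewrite -!natrX -natrM ler_nat.
have r3 : m%:R ^+ k <= n%:R ^+ l :> R by rewrite -!natrX ler_nat.
exists N, 'I_(s ^ k), (fun i (e : 'I_(s ^ k)) => pt i e), (n%:R ^+ (a + l))^-1;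
  split=> //.
- by rewrite -ltnS NE; apply: leq_trans (ltn_expl N0 hn) _;
    rewrite leq_exp2l// leqnSn.
- by rewrite card_ord; apply: card_power_bound => //; apply: ltnW; rewrite NE ltnW.
split.
- move=> i e iN; rewrite ler_pdivlMr// mulrC xfull -?NE// 1?ltnW//.
  by rewrite -natr1 opprD addrA subrr sub0r normrN1; lra.
- move=> i i' e e' iN iN' ne; rewrite -div1r ler_pdivrMr// [leRHS]mulrC.
  have d0 := mdist_ge0 (pt i e) (pt i' e').
  case: (eqVneq e e') => [ee|ee].
    have ii : i <> i' by move=> E; rewrite E ee eqxx in ne.
    rewrite -NE in xsep; apply: le_trans (xsep i i' e iN iN' ii) _;
      rewrite ee in d0 *.
    by rewrite ler_pM2l// ler_peMl//; lra.
  have ene : e <> e' :> nat by move=> /val_inj E; rewrite E eqxx in ee.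
  apply: le_trans (ysep i i' e e' (ltn_ord e) (ltn_ord e') ene) _.
  rewrite mulrA; apply: ler_wpM2r => //.
  apply: (@le_trans _ _ (m%:R * n%:R ^+ a * n%:R ^+ l)).
    by rewrite exprD; apply: ler_pM => //; exact: ltW.
  by rewrite -mulrA -exprD [leLHS]mulrC ler_pM2l//; lra.
- move=> i i' e e' iN iN'; apply: le_trans (near _ _ _ _) _.
  apply: (@le_trans _ _ (2 * (n%:R ^+ a)^-1)).
    by have : (m%:R ^+ b)^-1 <= (n%:R ^+ a)^-1 :> R; [rewrite lef_pV2 ?posrE|lra].
  rewrite exprD invfM mulrCA [leLHS]mulrC ler_pM2l ?invr_gt0// ler_pdivlMr//.
  by have : 0 <= (N%:R : R); [exact: ler0n|nra].
- move=> e; rewrite ler_pdivrMr// -mulrA [mdist _ _ * _]mulrC xfull -?NE//.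
  by rewrite sub0r normrN normr_nat ler_peMl//; lra.
Qed.

(** The segments are vertical: [y] runs through [m ^ k] equally spaced values
while [x] moves by [n ^ -b], which is less than the step; the fibres are the
[t ^ l] words of digits of [x] in the row [j]. *)
Lemma grids_full_column : s = m -> (forall d, (d < m)%N -> (rowpt d).2 = d :> nat)
  ->
  has_grids S (2 * m%:R + 2) t%:R^-1 (log_base R n t).
Proof.
move=> sm full N0; have m1R : 1 < m%:R :> R := m1; pose k := N0.+1;
  pose l := trunc_log n (m ^ k).
have mk0 : (0 < m ^ k)%N by rewrite expn_gt0 (ltnW hm).
have /andP[l1 l2] := trunc_log_bounds hn mk0; rewrite -/l in l1 l2.
have [a [b [abK h1 h2 h3]]] := grid_parameters (k + l) hm hmn.
have alb : (a + l <= b)%N by rewrite (leq_trans _ abK)// leq_add2l leq_addl.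
have [pt [xsep ysep near _ yfull]] :=
  word_points_exist R hm hn s0 t0 colptA colpt_inj rowptA rowpt_inj k alb.
have {}yfull := yfull sm full; rewrite sm in ysep.
pose N := (m ^ k).-1.
have NE : (N.+1 = m ^ k)%N by rewrite prednK.
have NR : N%:R + 1 = m%:R ^+ k :> R by rewrite natr1 NE natrX.
have Nk2 : 2 <= m%:R ^+ k :> R.
  by rewrite -natrX ler_nat (leq_trans hm)// -[m in leqLHS]expn1 leq_exp2l.
have lam0 : 0 < (m%:R ^+ (b + k))^-1 :> R by rewrite invr_gt0.
have r1 : n%:R ^+ a <= m%:R ^+ b :> R by rewrite -!natrX ler_nat.
have r2 : m%:R ^+ b <= m%:R * n%:R ^+ a :> R by rewrite -!natrX -natrM ler_nat.
have r3 : n%:R ^+ l <= m%:R ^+ k :> R by rewrite -!natrX ler_nat.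
have r4 : m%:R ^+ (b + k) / n%:R ^+ b <= 1 :> R.
  rewrite ler_pdivrMr// mul1r -!natrX ler_nat; apply: leq_trans h3.
  by rewrite leq_exp2l// addnA leq_addr.
exists N, 'I_(t ^ l), (fun i (c : 'I_(t ^ l)) => pt c i), (m%:R ^+ (b + k))^-1;
  split=> //.
- by rewrite -ltnS NE; apply: leq_trans (ltn_expl N0 hm) _;
    rewrite leq_exp2l// leqnSn.
- by rewrite card_ord; apply: card_power_bound => //; apply: ltnW; rewrite NE ltnW.
split.
- move=> i c iN; rewrite ler_pdivlMr// mulrC.
  have im1 : (i.+1 < m ^ k)%N by rewrite -NE ltnS.
  have /andP[_ up] := yfull c i i.+1 (ltnW im1) im1.
  apply: le_trans up _.
  by rewrite -natr1 opprD addrA subrr sub0r normrN1; lra.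
- move=> i i' c c' iN iN' ne; rewrite -div1r ler_pdivrMr// [leRHS]mulrC.
  have d0 := mdist_ge0 (pt c i) (pt c' i').
  case: (eqVneq i i') => [ii|/eqP ii]; last first.
    rewrite -NE in ysep; apply: le_trans (ysep c c' i i' iN iN' ii) _.
    by rewrite ler_pM2l// ler_peMl//; lra.
  have cc : c <> c' :> nat by move=> /val_inj E; rewrite E ii eqxx in ne.
  rewrite ii in d0 *; apply: le_trans (xsep c c' i' (ltn_ord c) (ltn_ord c') cc) _.
  rewrite mulrA; apply: ler_wpM2r => //.
  apply: (@le_trans _ _ (m%:R ^+ (b + k)));
    last by rewrite ler_peMr ?(ltW (mX _))//; lra.
  by rewrite !exprD; apply: ler_pM => //; exact: ltW.
- move=> i i' c c' iN iN'; apply: le_trans (near _ _ _ _) _.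
  have e1 : (n%:R ^+ a)^-1 <= m%:R * (m%:R ^+ b)^-1 :> R.
    by rewrite -div1r ler_pdivrMr// mulrAC ler_pdivlMr// mul1r.
  apply: (@le_trans _ _ ((m%:R + 1) * (m%:R ^+ b)^-1)); first by lra.
  rewrite exprD invfM mulrCA [leLHS]mulrC ler_pM2l ?invr_gt0// ler_pdivlMr//.
  by have : 0 <= (N%:R : R); [exact: ler0n|nra].
- move=> c; rewrite ler_pdivrMr// -mulrA [mdist _ _ * _]mulrC.
  have Nm : (N < m ^ k)%N by rewrite -NE.
  have /andP[lo _] := yfull c 0%N N mk0 Nm.
  rewrite sub0r normrN normr_nat in lo; apply: le_trans lo _.
  by rewrite ler_peMl ?mulr_ge0 ?mdist_ge0 ?(ltW (mX _))//; lra.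
Qed.

End grids.

(** * Digit counts and the conclusion *)

Lemma inj_to_ord (T : finType) (B : {pred T}) k : (#|B| <= k.+1)%N ->
  exists f : T -> 'I_k.+1, {in B &, injective f}.
Proof.
move=> Bk; exists (fun x => inord (index x (enum B))) => x y xB yB /(congr1 val) /=.
have lt z : z \in B -> (index z (enum B) < k.+1)%N.
  by move=> zB; apply: leq_trans Bk; rewrite cardE index_mem mem_enum.
by rewrite !inordK ?lt//; apply: (index_inj x); rewrite mem_enum.
Qed.

Section digit_counts.
Variables (n m : nat) (A : {set 'I_n * 'I_m}).
Hypothesis A0 : A != finset.set0.

Lemma row_count_neq0 x : x \in A -> row_count A x.2 != 0%N.
Proof. by move=> xA; rewrite /row_count -lt0n; apply/card_gt0P; exists x;
  rewrite inE xA eqxx. Qed.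

Lemma row_count_le j : (row_count A j <= n)%N.
Proof.
rewrite -[leqRHS]card_ord /row_count -(card_in_imset (f := fst));
  first exact: max_card.
move=> [x1 x2] [y1 y2]; rewrite !inE => /andP[_ /eqP/= ->] /andP[_ /eqP/= ->] /= ->.
by [].
Qed.

Lemma num_rows_gt0 : (0 < num_rows A)%N.
Proof.
have /set0Pn[x xA] := A0.
by apply/card_gt0P; exists x.2; rewrite inE row_count_neq0.
Qed.

Lemma num_rows_le : (num_rows A <= m)%N.
Proof. by rewrite -[leqRHS]card_ord max_card. Qed.

Lemma row_count_max j : (row_count A j <= max_row_count A)%N.
Proof. exact: (leq_bigmax (F := row_count A)). Qed.

Lemma max_row_count_gt0 : (0 < max_row_count A)%N.
Proof.
have /set0Pn[x xA] := A0.
by apply: leq_trans (row_count_max x.2); rewrite lt0n row_count_neq0.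
Qed.

Lemma max_row_exists : exists j, row_count A j = max_row_count A.
Proof.
have /set0Pn[x xA] := A0.
have m0 : (0 < #|'I_m|)%N by apply/card_gt0P; exists x.2.
by have [j jE] := bigop.eq_bigmax (row_count A) m0; exists j.
Qed.

Lemma max_row_count_le : (max_row_count A <= n)%N.
Proof. by have [j <-] := max_row_exists; exact: row_count_le. Qed.

Lemma col_code_exists t : max_row_count A = t.+1 ->
  exists fcol : 'I_n * 'I_m -> 'I_t.+1,
    {in A &, forall x y, x.2 = y.2 -> fcol x = fcol y -> x = y}.
Proof.
move=> tE.
have /choice[f fP] : forall j, exists f : 'I_n * 'I_m -> 'I_t.+1,
    {in [pred a in A | a.2 == j] &, injective f}.
  by move=> j; apply: inj_to_ord; rewrite -tE row_count_max.
exists (fun x => f x.2 x) => x y xA yA xy; rewrite -xy.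
by apply: (fP x.2); rewrite inE ?xA ?yA ?xy eqxx.
Qed.

Lemma row_code_exists s : num_rows A = s.+1 ->
  exists frow : 'I_m -> 'I_s.+1,
    {in A &, forall x y, frow x.2 = frow y.2 -> x.2 = y.2}.
Proof.
move=> sE; have [|f fP] := @inj_to_ord _ [pred j : 'I_m | row_count A j != 0%N] s.
  by rewrite -sE.
by exists f => x y xA yA; apply: fP; rewrite inE row_count_neq0.
Qed.

Lemma row_gap_exists j : (max_row_count A < n)%N -> exists i, (i, j) \notin A.
Proof.
move=> tn; apply/existsP; rewrite -[X in is_true X]negbK negb_exists.
apply/negP => /forallP all_in.
suff : (n <= row_count A j)%N by rewrite leqNgt (leq_ltn_trans (row_count_max j)
  tn).
rewrite -[leqLHS]card_ord -(card_imset _ (fun (x y : 'I_n) (h : (x, j) = (y, j))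
  => congr1 fst h)).
apply/subset_leq_card/fintype.subsetP => _ /imsetP[i _ ->]; rewrite inE eqxx andbT.
by have := all_in i; rewrite negbK.
Qed.

Lemma full_rowP j : row_count A j = n -> forall i, (i, j) \in A.
Proof.
move=> jn i; apply: contrapT => /negP ij.
have : (n < n)%N; last by rewrite ltnn.
rewrite -{1}jn -[ltnRHS]card_ord;
  apply: (@leq_trans #|finset.setC [set i]%SET|.+1); last first.
  by rewrite cardsC1 prednK//; apply/card_gt0P; exists i.
rewrite ltnS /row_count -(card_in_imset (f := fst)); last first.
  by move=> [x1 x2] [y1 y2]; rewrite !inE => /andP[_ /eqP/= ->] /andP[_ /eqP/= ->]
    /= ->.
apply/subset_leq_card/fintype.subsetP => i' /imsetP[[x1 x2]].
rewrite !inE => /andP[xA /eqP/= xj] ->; apply/eqP => /= E.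
by move: ij; rewrite -E -xj xA.
Qed.

Lemma empty_row_exists : (num_rows A < m)%N -> exists j0, forall x, x \in A -> x.2
  != j0.
Proof.
move=> sm; have : [exists j, row_count A j == 0%N].
  rewrite -[X in is_true X]negbK negb_exists; apply/negP => /forallP h.
  by move: sm; rewrite /num_rows (eq_card (B := 'I_m)) ?card_ord ?ltnn// => j;
    rewrite !inE h.
move=> /existsP[j /eqP j0]; exists j => x xA; apply/eqP => E.
by have := row_count_neq0 xA; rewrite E j0.
Qed.

Lemma row_repr_exists : exists f : 'I_m -> 'I_n * 'I_m,
  forall j, row_count A j != 0%N -> f j \in A /\ (f j).2 = j.
Proof.
have /set0Pn[x0 _] := A0.
suff /choice[f fP] : forall j, exists x, row_count A j != 0%N -> x \in A /\ x.2 =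
  j by exists f.
move=> j; case: (eqVneq (row_count A j) 0%N) => [_|]; first by exists x0.
rewrite -lt0n => /card_gt0P[x]; rewrite inE => /andP[xA /eqP xj].
by exists x.
Qed.

(** Listing the non-empty rows in increasing order makes the [d]-th one equal
to [d] when no row is empty. *)
Lemma row_points_exist : exists rowpt : nat -> 'I_n * 'I_m,
  [/\ forall d, (d < num_rows A)%N -> rowpt d \in A,
      forall d d', (d < num_rows A)%N -> (d' < num_rows A)%N ->
        (rowpt d).2 = (rowpt d').2 -> d = d'
    & num_rows A = m -> forall d, (d < m)%N -> (rowpt d).2 = d :> nat].
Proof.
have [f fP] := row_repr_exists; have /set0Pn[x0 _] := A0.
pose rows := enum [pred j : 'I_m | row_count A j != 0%N].
have rowsE : size rows = num_rows A by rewrite /rows -cardE.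
have rowsP d : (d < num_rows A)%N -> f (nth x0.2 rows d) \in A /\
    (f (nth x0.2 rows d)).2 = nth x0.2 rows d.
  by rewrite -rowsE => d_lt; apply: fP; have := mem_nth x0.2 d_lt;
    rewrite mem_enum inE.
exists (fun d => f (nth x0.2 rows d)); split.
- by move=> d /rowsP[].
- move=> d d' dl dl'; rewrite (rowsP d dl).2 (rowsP d' dl').2 => /eqP.
  by rewrite nth_uniq ?rowsE ?enum_uniq// => /eqP.
move=> sm d dm; rewrite (rowsP d _).2 ?sm//.
have -> : rows = enum 'I_m.
  have E : #|[pred j : 'I_m | row_count A j != 0%N]| = #|'I_m| by rewrite card_ord
    -[RHS]sm.
  apply: eq_enum => j; have /(subset_cardP E)/(_ j) -> // := subset_predT [pred j
    : 'I_m | row_count A j != 0%N].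
by rewrite nth_enum_ord.
Qed.

Lemma col_points_exist : exists (j : 'I_m) (colpt : nat -> 'I_n * 'I_m),
  [/\ forall d, (d < max_row_count A)%N -> colpt d \in A /\ (colpt d).2 = j,
      forall d d', (d < max_row_count A)%N -> (d' < max_row_count A)%N ->
        (colpt d).1 = (colpt d').1 -> d = d'
    & max_row_count A = n -> forall d, (d < n)%N -> (colpt d).1 = d :> nat].
Proof.
have [j jE] := max_row_exists; exists j; have /set0Pn[x0 _] := A0.
pose cols := [seq i <- enum 'I_n | (i, j) \in A].
have cols_uniq : uniq cols by apply: filter_uniq; exact: enum_uniq.
have colsE : size cols = max_row_count A.
  rewrite -jE /row_count -(card_in_imset (f := fst)); last first.
    by move=> [x1 x2] [y1 y2]; rewrite !inE => /andP[_ /eqP/= ->] /andP[_ /eqP/=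
      ->] /= ->.
  rewrite cardE; apply/perm_size/uniq_perm => [//||i]; first exact: enum_uniq.
  rewrite mem_filter !mem_enum inE andbT; apply/idP/imsetP => [ij|[[x1 x2]]].
    by exists (i, j); rewrite // inE ij eqxx.
  by rewrite inE => /andP[xA /eqP/= <-] ->.
exists (fun d => (nth x0.1 cols d, j));
  split=> [d dl|d d' dl dl' /= /eqP|tn d dn] /=.
- by split=> //; have := mem_nth x0.1 (_ : (d < size cols)%N);
    rewrite colsE => /(_ dl); rewrite mem_filter => /andP[].
- by rewrite nth_uniq ?colsE// => /eqP.
have -> : cols = enum 'I_n.
  by apply/all_filterP/allP => i _; apply: full_rowP; rewrite jE.
by rewrite nth_enum_ord.
Qed.

End digit_counts.

Lemma identity_quasisymmetric (R : realType) (X : metricType R) :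
  quasisymmetric (fun x : X => x).
Proof.
have id_homeo (T : topologicalType) : homeomorphism (@id T).
  by exists id; split=> // x; exact: cvg_id.
by split; [exact: id_homeo|exists id; [exact: id_homeo|move=> x a b _;
  exact: lexx]].
Qed.

Theorem theorem1p2 (R : realType) (n m : nat) (hm : (2 <= m)%N) (hmn : (m < n)%N)
    (A : {set 'I_n * 'I_m}) (hA : A != finset.set0) :
  let S := set_type (carpet R A) in
  let s := num_rows A in
  let t := max_row_count A in
  ((t < n)%N /\ (s < m)%N -> conformal_assouad_dim S = 0%E) /\
  (~ ((t < n)%N /\ (s < m)%N) -> conformal_assouad_dim S = assouad_dim S).
Proof.
move=> S s t; have hn := ltn_trans hm hmn.
have s0 : (0 < s)%N := num_rows_gt0 hA.
have t0 : (0 < t)%N := max_row_count_gt0 hA.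
pose alpha := log_base R m s + log_base R n t.
have ls0 := log_base_ge0 R hm s0; have lt0 := log_base_ge0 R hn t0.
have cov : covering_exponent S alpha.
  rewrite /alpha; have [sE tE] := (prednK s0, prednK t0).
  have [frow frowP] := row_code_exists (esym sE).
  have [fcol fcolP] := col_code_exists (esym tE).
  by rewrite -sE -tE; exact: carpet_covering_exponent frowP fcolP.
split=> [[tn sm]|H].
  have n0 : 0 < (n%:R : R) by rewrite ltr0n ltnW.
  have C0 : 0 < 4 * n%:R ^+ 5 :> R by rewrite mulr_gt0// exprn_gt0.
  have ud := @carpet_uniformly_disconnected R n m hm hmn A
    (fun j => row_gap_exists j tn) (empty_row_exists sm).
  apply: (conformal_assouad_dim_eq0 C0 ud (alpha := alpha + 1)).
    by rewrite ltr_pwDr// addr_ge0.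
  by apply: le_covering_exponent cov; rewrite lerDl.
have [rowpt [rowA rowinj rowfull]] := row_points_exist hA.
have [j [colpt [colA colinj colfull]]] := col_points_exist hA.
have L1 : 1 <= 2 * m%:R + 2 :> R by have : 0 <= m%:R :> R by []; lra.
have full : t = n \/ s = m.
  have [|tn] := eqVneq t n; [by left|right].
  apply/eqP; rewrite eqn_leq num_rows_le leqNgt; apply/negP => sm; apply: H.
  by rewrite sm ltn_neqAle tn; split=> //; exact: max_row_count_le.
have lower (Y : metricType R) (f : S -> Y) beta : quasisymmetric f -> 0 < beta ->
    assouad_exponent Y beta -> alpha <= beta.
  move=> qs beta0 exb; have [tn|sm] := full.
    rewrite /alpha tn log_base_self// addrC.
    apply: (assouad_exponent_ge_grids L1 _ ls0 beta0 _ qs exb (c := s%:R^-1)).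
      by rewrite invr_gt0 ltr0n.
    exact: (grids_full_row R hm hmn s0 t0 colA colinj rowA rowinj tn (colfull tn)).
  rewrite /alpha sm log_base_self//.
  apply: (assouad_exponent_ge_grids L1 _ lt0 beta0 _ qs exb (c := t%:R^-1)).
    by rewrite invr_gt0 ltr0n.
  exact: (grids_full_column R hm hmn s0 t0 colA colinj rowA rowinj sm (rowfull sm)).
have cdim_le : (conformal_assouad_dim S <= assouad_dim S)%E.
  apply: ereal_inf_lbound; exists S => //.
  by exists (fun x : S => x); exact: identity_quasisymmetric.
apply/eqP; rewrite eq_le cdim_le andTb.
have alpha0 : 0 < alpha.
  rewrite /alpha; have [tn|sm] := full.
    by rewrite tn log_base_self// ltr_wpDl.
  by rewrite sm log_base_self// ltr_pwDl.
apply: (@le_trans _ _ alpha%:E).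
  apply: ereal_inf_lbound; exists alpha => //; split=> //.
  exact: covering_assouad_exponent.
apply: le_ereal_inf_tmp => _ [Y [f qs] ->].
by apply: le_ereal_inf_tmp => _ [beta [beta0 exb] <-]; rewrite lee_fin;
  exact: lower qs beta0 exb.
Qed.
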